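(* Let each $\ell_i:\mathbb{R}\to\mathbb{R}$ ($i\in[n]$) be convex and $L_i$-smooth with $L_i>0$, let $f(\mathbf{x})=\frac1n\sum_{i=1}^n\ell_i(\mathbf{a}_i^\top\mathbf{x})$ have a minimizer $\mathbf{x}_*\in\mathbb{R}^d$, and let $\sigma_*^2=\frac1n\sum_{i=1}^n(\ell_i'(\mathbf{a}_i^\top\mathbf{x}_* ))^2\|\mathbf{a}_i\|_2^2$ (assumed finite). Run shuffled SGD (Algorithm 1, described in the context) for $K\ge 1$ epochs with batch size $b$, with uniformly random shuffling (either the SO or the RR scheme), and with deterministic step sizes $\eta_1,\dots,\eta_K>0$ such that, for each $k\in[K]$, $$\eta_k\le \frac{b}{n\sqrt{2\hat L_{\pi^{(k)}}\tilde L_{\pi^{(k)}}}}$$ (for every realization of $\pi^{(k)}$). Let $H_K=\sum_{k=1}^K\eta_k$. Then the output $\hat{\mathbf{x}}_K$ satisfies $$\mathbb{E}\big[H_K\big(f(\hat{\mathbf{x}}_K)-f(\mathbf{x}_* )\big)\big]\le \frac{b}{2n}\|\mathbf{x}_0-\mathbf{x}_*\|_2^2+\sum_{k=1}^K\frac{\eta_k^3\tilde L(n-b)(n+b)}{6b^2(n-1)}\sigma_*^2 .$$ Consequently, given $\epsilon>0$, there exists a constant step size $\eta_k=\eta$ for which $\mathbb{E}[f(\hat{\mathbf{x}}_K)-f(\mathbf{x}_* )]\le\epsilon$ after $$\mathcal{O}\Big(\frac{n\sqrt{\hat L\tilde L}\,\|\mathbf{x}_0-\mathbf{x}_*\|_2^2}{\epsilon}+\sqrt{\frac{(n-b)(n+b)}{n(n-1)}}\;\frac{\sqrt{n\tilde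 L}\,\sigma_*\|\mathbf{x}_0-\mathbf{x}_*\|_2^2}{\epsilon^{3/2}}\Big)$$ individual gradient queries; that is, there is an absolute constant $C>0$ such that for every $\epsilon>0$ and every integer $K\ge1$ with $nK$ at least $C$ times the expression inside $\mathcal{O}(\cdot)$, some constant step size $\eta>0$ gives $\mathbb{E}[f(\hat{\mathbf{x}}_K)-f(\mathbf{x}_* )]\le\epsilon$.
   Context: Setting: $n\ge2$, $d,b,m\ge 1$ are integers with $n=bm$; $[n]=\{1,\dots,n\}$; $\mathbf{a}_1,\dots,\mathbf{a}_n\in\mathbb{R}^d$. A differentiable $\ell_i$ is $L_i$-smooth if $|\ell_i'(x)-\ell_i'(y)|\le L_i|x-y|$ for all $x,y\in\mathbb{R}$. $\ell_i^*$ denotes the convex conjugate of $\ell_i$. $\|\cdot\|_2$ is the Euclidean norm for vectors and the operator norm for matrices. For a permutation $\pi=(\pi_1,\dots,\pi_n)$ of $[n]$: $\mathbf{A}_\pi=[\mathbf{a}_{\pi_1},\dots,\mathbf{a}_{\pi_n}]^\top\in\mathbb{R}^{n\times d}$ and $\boldsymbol\Lambda_\pi=\mathrm{diag}(L_{\pi_1},\dots,L_{\pi_n})$. $\mathbf{I}_{j\uparrow}$ is the $n\times n$ identity matrix with its first $j$ diagonal entries set to zero; $\mathbf{I}_{(j)}$ is the $n\times n$ diagonal matrix with diagonal entries $1$ in positions $b(j-1)+1,\dots,bj$ and $0$ elsewhere. Define $$\hat L_\pi=\frac1{mn}\Big\|\boldsymbol\Lambda_\pi^{1/2}\Big(\sum_{j=1}^m\mathbf{I}_{b(j-1)\uparrow}\mathbf{A}_\pi\mathbf{A}_\pi^\top\mathbf{I}_{b(j-1)\uparrow}\Big)\boldsymbol\Lambda_\pi^{1/2}\Big\|_2,\qquad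 \tilde L_\pi=\frac1b\Big\|\boldsymbol\Lambda_\pi^{1/2}\Big(\sum_{j=1}^m\mathbf{I}_{(j)}\mathbf{A}_\pi\mathbf{A}_\pi^\top\mathbf{I}_{(j)}\Big)\boldsymbol\Lambda_\pi^{1/2}\Big\|_2,$$ $\hat L=\max_\pi\hat L_\pi$, $\tilde L=\max_\pi\tilde L_\pi$ (maxima over all permutations of $[n]$). A step-size bound with zero denominator is read as $+\infty$ (no restriction). Algorithm 1 (shuffled SGD, primal-dual view). Input: $\mathbf{x}_0\in\mathbb{R}^d$, batch size $b$, step sizes $\eta_k>0$, number of epochs $K$. For $k=1,\dots,K$: choose a permutation $\pi^{(k)}$ of $[n]$; set $\mathbf{A}_k=\mathbf{A}_{\pi^{(k)}}$, and let $\mathbf{A}_k^{(i)}\in\mathbb{R}^{b\times d}$ consist of rows $b(i-1)+1,\dots,bi$ of $\mathbf{A}_k$; set $\mathbf{x}_{k-1,1}=\mathbf{x}_{k-1}$; for $i=1,\dots,m$ set $\mathbf{y}_k^{(i)}=\operatorname{argmax}_{\mathbf{y}\in\mathbb{R}^b}\{\mathbf{y}^\top\mathbf{A}_k^{(i)}\mathbf{x}_{k-1,i}-\sum_{j=1}^b\ell^*_{\pi^{(k)}_{b(i-1)+j}}(\mathbf{y}^j)\}$ and $\mathbf{x}_{k-1,i+1}=\operatorname{argmin}_{\mathbf{x}\in\mathbb{R}^d}\{\mathbf{y}_k^{(i)\top}\mathbf{A}_k^{(i)}\mathbf{x}+\frac{b}{2\eta_k}\|\mathbf{x}-\mathbf{x}_{k-1,i}\|_2^2\}$;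 then set $\mathbf{x}_k=\mathbf{x}_{k-1,m+1}$. Equivalently, $\mathbf{x}_{k-1,i+1}=\mathbf{x}_{k-1,i}-\frac{\eta_k}{b}\sum_{j=b(i-1)+1}^{bi}\ell'_{\pi_j^{(k)}}(\mathbf{a}_{\pi_j^{(k)}}^\top\mathbf{x}_{k-1,i})\,\mathbf{a}_{\pi_j^{(k)}}$. Output: $\hat{\mathbf{x}}_K=\sum_{k=1}^K\eta_k\mathbf{x}_k/\sum_{k=1}^K\eta_k$. Each epoch uses $n$ individual gradient queries. Shuffling schemes: RR (random reshuffling): $\pi^{(1)},\dots,\pi^{(K)}$ are independent uniformly random permutations of $[n]$. SO (shuffle once): $\pi^{(k)}=\pi$ for all $k$, with a single uniformly random permutation $\pi$. Expectations are over this randomness; $\mathbf{x}_0$ is deterministic. *)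

(* Defs.v *)
(* Indices of batches, rows and coordinates are 0-based ordinals; epochs are
   numbered 1, ..., K by natural numbers.  The number of components is
   n = b * m throughout. *)
From HB Require Import structures.
From mathcomp Require Import all_boot all_order all_algebra all_fingroup.
From mathcomp Require Import all_classical all_reals all_analysis.

Set Implicit Arguments.
Unset Strict Implicit.
Unset Printing Implicit Defensive.

Import Order.TTheory GRing.Theory Num.Theory.
Import numFieldNormedType.Exports.

Local Open Scope classical_set_scope.
Local Open Scope ring_scope.

Definition argmin disp (V : porderType disp) (T : pointedType) (F : T -> V) : T :=
  get [set x | forall z, (F x <= F z)%O].

Definition argmax disp (V : porderType disp) (T : pointedType) (F : T -> V) : T :=
  get [set x | forall z, (F z <= F x)%O].

(* The library norm `|v| on matrices is the max norm, hence these two norms. *)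
Definition l2norm (R : realType) (p : nat) (v : 'cV[R]_p) : R :=
  Num.sqrt (\sum_(i < p) v i 0 ^+ 2).

Definition opnorm (R : realType) (p q : nat) (M : 'M[R]_(p, q)) : R :=
  sup [set l2norm (M *m v) | v in [set v : 'cV[R]_q | l2norm v <= 1]].

Definition dot (R : realType) (p : nat) (u v : 'cV[R]_p) : R :=
  (u^T *m v) 0 0.

Definition L_smooth (R : realType) (L : R) (f : R -> R) : Prop :=
  (forall x : R, derivable f x 1) /\
  (forall x y : R, `|derive1 f x - derive1 f y| <= L * `|x - y|).

Definition convex_conjugate (R : realType) (f : R -> R) (y : R) : \bar R :=
  ereal_sup [set (y * x - f x)%:E | x in [set: R]].

Section FiniteSum.
Variables (R : realType) (n d : nat).
Variables (a : 'I_n -> 'cV[R]_d) (ell : 'I_n -> R -> R).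

Definition objective (x : 'cV[R]_d) : R :=
  n%:R^-1 * \sum_(i < n) ell i (dot (a i) x).

Definition sigma_sq (x : 'cV[R]_d) : R :=
  n%:R^-1 * \sum_(i < n) (derive1 (ell i) (dot (a i) x)) ^+ 2 * l2norm (a i) ^+ 2.

End FiniteSum.

Section ShuffledSGD.
Variables (R : realType) (d b m : nat).
Local Notation n := (b * m)%N.
Variables (a : 'I_n -> 'cV[R]_d) (ell : 'I_n -> R -> R) (L : 'I_n -> R).

Definition A_perm (s : 'S_n) : 'M[R]_(n, d) := \matrix_(i, c) a (s i) c 0.

Definition sqrt_Lambda (s : 'S_n) : 'M[R]_n :=
  diag_mx (\row_i Num.sqrt (L (s i))).

Definition I_up (j : nat) : 'M[R]_n := diag_mx (\row_(p < n) (j <= p)%N%:R).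

Definition I_block (j : nat) : 'M[R]_n :=
  diag_mx (\row_(p < n) (b * j <= p < b * j.+1)%N%:R).

Definition Lhat_perm (s : 'S_n) : R :=
  (m%:R * n%:R)^-1 *
  opnorm (sqrt_Lambda s *m
    (\sum_(j < m) I_up (b * j) *m A_perm s *m (A_perm s)^T *m I_up (b * j))
    *m sqrt_Lambda s).

Definition Ltilde_perm (s : 'S_n) : R :=
  b%:R^-1 *
  opnorm (sqrt_Lambda s *m
    (\sum_(j < m) I_block j *m A_perm s *m (A_perm s)^T *m I_block j)
    *m sqrt_Lambda s).

(* The values are nonnegative, so the default 0 does not affect the maxima. *)
Definition Lhat : R := \big[Num.max/0]_(s : 'S_n) Lhat_perm s.
Definition Ltilde : R := \big[Num.max/0]_(s : 'S_n) Ltilde_perm s.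

Definition step_bound (s : 'S_n) : \bar R :=
  let D := n%:R * Num.sqrt (2 * Lhat_perm s * Ltilde_perm s) in
  if D == 0 then +oo%E else (b%:R / D)%:E.

Fact batch_pos_subproof (i : 'I_m) (j : 'I_b) : (b * i + j < n)%N.
Proof.
apply: (@leq_trans (b * i.+1)%N); last by rewrite leq_mul2l ltn_ord orbT.
by rewrite mulnS addnC ltn_add2r ltn_ord.
Qed.

Definition batch_pos (i : 'I_m) (j : 'I_b) : 'I_n :=
  Ordinal (batch_pos_subproof i j).

Definition A_batch (s : 'S_n) (i : 'I_m) : 'M[R]_(b, d) :=
  \matrix_(j, c) A_perm s (batch_pos i j) c.

(* A convex conjugate never takes the value -oo, so the objective below is
   never of the form oo - oo. *)
Definition dual_step (s : 'S_n) (i : 'I_m) (x : 'cV[R]_d) : 'cV[R]_b :=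
  argmax (fun y : 'cV[R]_b =>
    (((y^T *m A_batch s i *m x) 0 0)%R%:E
     - \sum_(j < b) convex_conjugate (ell (s (batch_pos i j))) (y j 0%R))%E).

Definition primal_step (eta : R) (s : 'S_n) (i : 'I_m) (x : 'cV[R]_d) :
    'cV[R]_d :=
  argmin (fun z : 'cV[R]_d =>
    ((dual_step s i x)^T *m A_batch s i *m z) 0 0
    + b%:R / (2 * eta) * l2norm (z - x) ^+ 2).

Definition epoch (eta : R) (s : 'S_n) (x : 'cV[R]_d) : 'cV[R]_d :=
  foldl (fun z i => primal_step eta s i z) x (enum 'I_m).

Fixpoint sgd_iter (eta : nat -> R) (s : nat -> 'S_n) (x0 : 'cV[R]_d) (k : nat) :
    'cV[R]_d :=
  if k is k'.+1 then epoch (eta k) (s k) (sgd_iter eta s x0 k') else x0.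

Definition sgd_output (eta : nat -> R) (s : nat -> 'S_n) (x0 : 'cV[R]_d)
    (K : nat) : 'cV[R]_d :=
  (\sum_(1 <= k < K.+1) eta k)^-1 *:
  \sum_(1 <= k < K.+1) eta k *: sgd_iter eta s x0 k.

End ShuffledSGD.

Section Shuffling.
Variables (R : realType) (disp : measure_display) (T : measurableType disp).
Variables (P : probability T R) (n : nat).

Definition uniform_perm (p : T -> 'S_n) : Prop :=
  forall s : 'S_n,
    measurable (p @^-1` [set s]) /\ P (p @^-1` [set s]) = (n`!%:R^-1)%:E.

(* For discrete random variables, mutual independence is the product rule for
   all tuples of values. *)
Definition random_reshuffling (K : nat) (pi : nat -> T -> 'S_n) : Prop :=
  (forall k, (1 <= k <= K)%N -> uniform_perm (pi k)) /\
  (forall s : nat -> 'S_n,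
    P (\bigcap_(k in [set k | (1 <= k <= K)%N]) (pi k @^-1` [set s k])) =
    (\prod_(1 <= k < K.+1) P (pi k @^-1` [set s k]))%E).

Definition shuffle_once (K : nat) (pi : nat -> T -> 'S_n) : Prop :=
  exists2 p : T -> 'S_n, uniform_perm p &
    forall k w, (1 <= k <= K)%N -> pi k w = p w.

End Shuffling.

(* Main.v *)
Require Import Defs.
From HB Require Import structures.
From mathcomp Require Import all_boot all_order all_algebra all_fingroup.
From mathcomp Require Import all_classical all_reals all_analysis.
From mathcomp Require Import measurable_realfun ring lra.

Set Implicit Arguments.
Unset Strict Implicit.
Unset Printing Implicit Defensive.

Import Order.TTheory GRing.Theory Num.Theory.
Import numFieldNormedType.Exports.

Local Open Scope classical_set_scope.
Local Open Scope ring_scope.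

(** Fix an epoch with permutation [s].  Let [z 0, ..., z m] be its iterates,
    [y p] the derivative of the loss in position [p] at the iterate where its
    batch is processed, [v p] the derivative at the end [z m] of the epoch and
    [ys p] the derivative at the minimizer [xs].  By the Fenchel-Young equality
    the dual step computes [y], and the primal step is then the gradient step
    ([dual_stepE], [primal_stepE]).

    For each loss, cocoercivity between [z m] and the iterate of the batch, and
    then between this iterate and [xs], bounds the gap at the end of the epoch by
    first-order terms minus [(v - y)^2 / (2 L)] and [(y - ys)^2 / (2 L)]
    ([loss_gap_le]).  Summed over the losses, the first-order terms consist of a
    three-point expression, whose squared distances telescope over the epochs
    ([three_point_le]), and of the cross terms
    [- (eta / b) * \sum_j <B_j (v - y), T_j y>].  Here [B_j w] and [T_j w] sum
    the vectors [w p *: a (s p)] over batch [j], and over batch [j] and all later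
    ones, because [z m - z j] is [- (eta / b) *: T_j y].  The constants
    [Ltilde] and [Lhat] are made to bound [\sum_j |B_j w|^2] and
    [\sum_j |T_j w|^2] by the norm of [w] weighted by [1 / L]
    ([block_sum_le_Ltilde], [tail_sum_le_Lhat]).  Hence, after writing [y] as
    [(y - ys) + ys], Young's inequality lets the negative squares absorb
    everything but a multiple of [\sum_j |T_j ys|^2] ([cross_terms_le],
    [epoch_descent]).

    This remainder depends on the permutation only.  The vectors [ys p *: a (s p)]
    sum to zero, by optimality of [xs], so [T_j ys] is a centered sum of
    [N = n - b j] vectors drawn without replacement, and its mean square is
    [N (n - N) / (n - 1) * sigma^2].  Summing over [j] produces the factor
    [(n - b) (n + b)] ([mean_tail_sums]).  The bound is a sum over the epochs of
    functions of one permutation each, and in both shuffling schemes each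
    permutation is uniform ([sgd_expectation]).  The averaged output is handled by
    convexity ([objective_jensen]), and the complexity bound follows from the step
    size [b |x0 - xs|^2 / (n K eps)] ([complexity_step]). *)

(** * Convex smooth functions of one variable *)

Lemma max_of_derive_sign (R : realType) (F dF : R -> R) (x : R) :
  (forall t, is_derive t (1 : R) F (dF t)) -> (forall t, dF t * (t - x) <= 0) ->
  forall y, F y <= F x.
Proof.
move=> FD Fs y.
have Fc (u v : R) : {within `[u, v], continuous F}.
  by apply: derivable_within_continuous => t _; exact: ex_derive.
case: (ltgtP x y) => [xy|yx|->//].
  have [c] := MVT xy (fun t _ => FD t) (@Fc x y).
  rewrite in_itv /= => /andP[xc cy] E.
  have c0 : 0 < c - x by rewrite subr_gt0.
  have := Fs c; rewrite pmulr_lle0 // => d0.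
  by rewrite -subr_le0 E pmulr_lle0 // subr_gt0.
have [c] := MVT yx (fun t _ => FD t) (@Fc y x).
rewrite in_itv /= => /andP[xc cy] E.
have c0 : c - x < 0 by rewrite subr_lt0.
have := Fs c; rewrite nmulr_lle0 // => d0.
by rewrite -subr_ge0 E pmulr_lge0 // subr_gt0.
Qed.

(** Every later use of differentiability goes through this two-sided bound: it
    turns the first-order conditions below into comparisons of a linear with a
    quadratic function, so that no further limits are taken. *)
Lemma smooth_quadratic_bound (R : realType) (L : R) (f : R -> R) :
  L_smooth L f ->
  forall x y, `|f y - f x - derive1 f x * (y - x)| <= L / 2 * (y - x) ^+ 2.
Proof.
move=> [df Lf] x y.
suff K (e : R) : `|e| <= 1 ->
    e * (f y - f x - derive1 f x * (y - x)) <= L / 2 * (y - x) ^+ 2.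
  rewrite ler_norml; have /K : `|1 : R| <= 1 by rewrite normr1.
  have /K : `|-1 : R| <= 1 by rewrite normrN1.
  by rewrite mulN1r mul1r lerNl => -> ->.
move=> e1.
pose F t := e * (f t - derive1 f x * t) - L / 2 * (t - x) ^+ 2.
pose dF t := e * (derive1 f t - derive1 f x) - L * (t - x).
have FD t : is_derive t (1 : R) F (dF t).
  have fD : is_derive t (1 : R) f (derive1 f t) by rewrite derive1E; exact: derivableP.
  rewrite /F.
  apply: is_derive_eq; rewrite /dF /GRing.scale /=. lra.
have Fs t : dF t * (t - x) <= 0.
  rewrite /dF mulrBl subr_le0; apply: le_trans (ler_norm _) _; rewrite !normrM.
  have -> : L * (t - x) * (t - x) = L * `|t - x| * `|t - x|.
    by rewrite -!mulrA -normrM -expr2 ger0_norm // sqr_ge0.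
  rewrite ler_wpM2r //; apply: le_trans (Lf t x).
  by rewrite -[leRHS]mul1r ler_wpM2r.
have := max_of_derive_sign FD Fs y.
by rewrite /F; lra.
Qed.

Lemma linear_le_quadratic (R : realType) (c q : R) :
  (forall t, 0 < t -> c * t <= q * t ^+ 2) -> c <= 0.
Proof.
move=> H; rewrite leNgt; apply/negP => c0.
have q0 : 0 < q.
  by have := H _ ltr01; rewrite expr1n !mulr1; exact: lt_le_trans.
have t0 : 0 < c / (2 * q) by rewrite divr_gt0 // mulr_gt0.
have := H _ t0; rewrite expr2 [leRHS]mulrA ler_pM2r //.
have -> : q * (c / (2 * q)) = c / 2 by field; rewrite gt_eqF.
lra.
Qed.

Lemma convex_chord (R : realType) (f : R -> R) :
  convex_function [set: convex_lmodType R^o] f ->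
  forall x y t, 0 <= t -> t <= 1 ->
  f (t * x + (1 - t) * y) <= t * f x + (1 - t) * f y.
Proof.
by move=> cf x y t t0 t1; apply: (cf (Itv01 t0 t1)); exact: in_setT.
Qed.

(** Along a segment the chord lies above the graph, and the graph lies above the
    tangent up to a quadratic error, which loses against the linear terms. *)
Lemma convex_ge_tangent (R : realType) (L : R) (f : R -> R) :
  convex_function [set: convex_lmodType R^o] f -> L_smooth L f ->
  forall x y, f x + derive1 f x * (y - x) <= f y.
Proof.
move=> cf Lf x y.
set h := y - x.
suff : derive1 f x * h - (f y - f x) <= 0 by lra.
apply: (@linear_le_quadratic _ _ `|L / 2 * h ^+ 2|) => t t0.
have L0 : 0 <= L / 2 * h ^+ 2.
  by apply: le_trans (smooth_quadratic_bound Lf x y).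
have [t1|t1] := leP t 1.
  have := convex_chord cf y x (ltW t0) t1.
  have -> : t * y + (1 - t) * x = x + t * h by rewrite /h; ring.
  have := smooth_quadratic_bound Lf x (x + t * h).
  rewrite ler_norml => /andP[+ _].
  have -> : x + t * h - x = t * h by ring.
  have -> : L / 2 * (t * h) ^+ 2 = L / 2 * h ^+ 2 * t ^+ 2 by ring.
  rewrite (ger0_norm L0); set q := L / 2 * h ^+ 2 * t ^+ 2; lra.
have := smooth_quadratic_bound Lf x y; rewrite -/h (ger0_norm L0).
rewrite ler_norml => /andP[+ _] => H.
have H2 : derive1 f x * h - (f y - f x) <= L / 2 * h ^+ 2 by lra.
rewrite expr2 mulrA ler_pM2r //.
apply: le_trans H2 _; rewrite -{1}[leLHS]mulr1 ler_wpM2l // ltW //.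
Qed.

(** Minimizing over a gradient step: subtracting the tangent at [u] makes [u]
    the minimizer, and one step of length [1 / L] from [w] decreases the
    function by the last term. *)
Lemma convex_smooth_cocoercive (R : realType) (L : R) (f : R -> R) :
  0 < L -> convex_function [set: convex_lmodType R^o] f -> L_smooth L f ->
  forall u w, f u <= f w + derive1 f u * (u - w)
                   - (2 * L)^-1 * (derive1 f u - derive1 f w) ^+ 2.
Proof.
move=> L0 cf Lf u w.
set g := derive1 f u - derive1 f w.
pose v := w + g / L.
have := convex_ge_tangent cf Lf u v.
have := smooth_quadratic_bound Lf w v.
rewrite ler_norml => /andP[_].
have -> : v - w = g / L by rewrite /v; ring.
have -> : v - u = g / L - (u - w) by rewrite /v; ring.
have -> : L / 2 * (g / L) ^+ 2 = (2 * L)^-1 * g ^+ 2 by field; rewrite gt_eqF.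
have E : derive1 f u * (g / L) - derive1 f w * (g / L) = 2 * ((2 * L)^-1 * g ^+ 2).
  by rewrite -mulrBl -/g; field; rewrite gt_eqF.
move: E; set q := (2 * L)^-1 * g ^+ 2; rewrite mulrBr; lra.
Qed.

(** * Euclidean vectors and the operator norm *)

Section Dot.
Variables (R : realType) (p : nat).
Implicit Types (u v w : 'cV[R]_p) (c : R).

Lemma dotE u v : dot u v = \sum_i u i 0 * v i 0.
Proof. by rewrite /dot mxE; apply: eq_bigr => i _; rewrite mxE. Qed.

Lemma dotC u v : dot u v = dot v u.
Proof. by rewrite !dotE; apply: eq_bigr => i _; rewrite mulrC. Qed.

Lemma dotDr u v w : dot u (v + w) = dot u v + dot u w.
Proof. by rewrite /dot mulmxDr mxE. Qed.

Lemma dotDl u v w : dot (v + w) u = dot v u + dot w u.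
Proof. by rewrite dotC dotDr !(dotC u). Qed.

Lemma dotZr u c v : dot u (c *: v) = c * dot u v.
Proof. by rewrite /dot -scalemxAr mxE. Qed.

Lemma dotZl u c v : dot (c *: v) u = c * dot v u.
Proof. by rewrite dotC dotZr dotC. Qed.

Lemma dotNr u v : dot u (- v) = - dot u v.
Proof. by rewrite -scaleN1r dotZr mulN1r. Qed.

Lemma dotNl u v : dot (- v) u = - dot v u.
Proof. by rewrite dotC dotNr dotC. Qed.

Lemma dotBr u v w : dot u (v - w) = dot u v - dot u w.
Proof. by rewrite dotDr dotNr. Qed.

Lemma dotBl u v w : dot (v - w) u = dot v u - dot w u.
Proof. by rewrite dotDl dotNl. Qed.

Lemma dot0r u : dot u 0 = 0.
Proof. by rewrite /dot mulmx0 mxE. Qed.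

Lemma dot0l u : dot 0 u = 0.
Proof. by rewrite dotC dot0r. Qed.

Lemma dot_sumr I (r : seq I) (P : pred I) (F : I -> 'cV[R]_p) u :
  dot u (\sum_(i <- r | P i) F i) = \sum_(i <- r | P i) dot u (F i).
Proof.
by elim/big_rec2: _ => [|i x y _ <-]; rewrite ?dot0r // dotDr.
Qed.

Lemma dot_suml I (r : seq I) (P : pred I) (F : I -> 'cV[R]_p) u :
  dot (\sum_(i <- r | P i) F i) u = \sum_(i <- r | P i) dot (F i) u.
Proof.
by rewrite dotC dot_sumr; apply: eq_bigr => i _; rewrite dotC.
Qed.

Lemma dot_ge0 u : 0 <= dot u u.
Proof. by rewrite dotE sumr_ge0 // => i _; rewrite -expr2 sqr_ge0. Qed.

Lemma dot_eq0 u : dot u u = 0 -> u = 0.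
Proof.
rewrite dotE => /psumr_eq0P H; apply/matrixP => i j; rewrite ord1 mxE.
have /eqP := H (fun i _ => sqr_ge0 (u i 0)) i isT.
by rewrite -expr2 sqrf_eq0 => /eqP.
Qed.

Lemma l2norm_sqr u : l2norm u ^+ 2 = dot u u.
Proof.
rewrite /l2norm sqr_sqrtr ?sumr_ge0 // => [|i _]; last exact: sqr_ge0.
by rewrite dotE; apply: eq_bigr => i _; rewrite expr2.
Qed.

Lemma l2normE u : l2norm u = Num.sqrt (dot u u).
Proof. by rewrite -l2norm_sqr sqrtr_sqr ger0_norm // sqrtr_ge0. Qed.

Lemma l2norm_ge0 u : 0 <= l2norm u.
Proof. exact: sqrtr_ge0. Qed.

Lemma l2normZ c u : l2norm (c *: u) = `|c| * l2norm u.
Proof.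
by rewrite !l2normE dotZl dotZr mulrA -expr2 sqrtrM ?sqr_ge0 // sqrtr_sqr.
Qed.

Lemma cauchy_schwarz u v : dot u v ^+ 2 <= dot u u * dot v v.
Proof.
have [v0|v0] := eqVneq (dot v v) 0.
  by rewrite (dot_eq0 v0) !dot0r expr0n mulr0.
have vp : 0 < dot v v by rewrite lt_neqAle eq_sym v0 dot_ge0.
have := dot_ge0 (u - (dot u v / dot v v) *: v).
rewrite dotBl !dotBr !dotZl !dotZr (dotC v u).
have -> : dot u u - dot u v / dot v v * dot u v -
  (dot u v / dot v v * dot u v - dot u v / dot v v * (dot u v / dot v v * dot v v))
  = (dot u u * dot v v - dot u v ^+ 2) / dot v v by field.
by rewrite pmulr_lge0 ?invr_gt0 // subr_ge0.
Qed.

Lemma dot_le_l2norm u v : dot u v <= l2norm u * l2norm v.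
Proof.
apply: le_trans (ler_norm _) _.
rewrite -ler_sqr ?nnegrE ?mulr_ge0 ?l2norm_ge0 //.
by rewrite real_normK ?num_real // exprMn !l2norm_sqr cauchy_schwarz.
Qed.

Lemma dot_le_young (al : R) u v : 0 < al ->
  2 * dot u v <= al * dot u u + al^-1 * dot v v.
Proof.
move=> al0; have := dot_ge0 (al *: u - v).
rewrite dotBl !dotBr !dotZl !dotZr (dotC v u) => H.
have : 0 <= al^-1 * (al * (al * dot u u) - al * dot u v - (al * dot u v - dot v v)).
  by rewrite mulr_ge0 // invr_ge0 ltW.
have -> : al^-1 * (al * (al * dot u u) - al * dot u v - (al * dot u v - dot v v))
   = al * dot u u + al^-1 * dot v v - 2 * dot u v by field; rewrite gt_eqF.
by rewrite subr_ge0.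
Qed.

End Dot.

Section Opnorm.
Variables (R : realType) (p q : nat) (M : 'M[R]_(p, q)).

Let image_ball := [set l2norm (M *m v) | v in [set v : 'cV[R]_q | l2norm v <= 1]].

Lemma has_sup_opnorm : has_sup image_ball.
Proof.
split; first by exists (l2norm (M *m 0)); exists 0 => //=; rewrite l2normE dot0l sqrtr0.
exists (Num.sqrt (\sum_i dot (row i M)^T (row i M)^T)) => _ [v /= v1 <-].
rewrite l2normE ler_wsqrtr // dotE ler_sum // => i _.
have -> : (M *m v) i 0 = dot (row i M)^T v.
  by rewrite mxE dotE; apply: eq_bigr => j _; rewrite !mxE.
rewrite -expr2; apply: le_trans (cauchy_schwarz _ _) _.
rewrite -[leRHS]mulr1 ler_wpM2l ?dot_ge0 //.
by rewrite -l2norm_sqr expr_le1 // l2norm_ge0.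
Qed.

Lemma opnorm_ge0 : 0 <= opnorm M.
Proof.
apply: (ub_le_sup has_sup_opnorm.2); exists 0; rewrite /= ?mulmx0 l2normE dot0l sqrtr0 //.
Qed.

Lemma l2norm_mulmx_le (v : 'cV[R]_q) : l2norm (M *m v) <= opnorm M * l2norm v.
Proof.
have [v0|v0] := eqVneq (l2norm v) 0.
  have -> : v = 0 by apply: dot_eq0; rewrite -l2norm_sqr v0 expr0n.
  by rewrite mulmx0 !l2normE !dot0l sqrtr0 mulr0.
have vp : 0 < l2norm v by rewrite lt_neqAle eq_sym v0 l2norm_ge0.
rewrite -ler_pdivrMr // mulrC -[X in X * _]ger0_norm ?invr_ge0 ?l2norm_ge0 //.
rewrite -l2normZ scalemxAr; apply: (ub_le_sup has_sup_opnorm.2).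
exists ((l2norm v)^-1 *: v) => //=.
by rewrite l2normZ ger0_norm ?invr_ge0 ?l2norm_ge0 // mulVf.
Qed.

End Opnorm.

Lemma dot_mulmx_le_opnorm (R : realType) (p : nat) (M : 'M[R]_p) (v : 'cV[R]_p) :
  dot v (M *m v) <= opnorm M * dot v v.
Proof.
apply: le_trans (dot_le_l2norm _ _) _.
rewrite -l2norm_sqr expr2 mulrA [leRHS]mulrC.
by rewrite ler_wpM2l ?l2norm_ge0 // l2norm_mulmx_le.
Qed.

Lemma dot_mulmx_sym (R : realType) (p q : nat) (B : 'M[R]_(p, q)) (v : 'cV[R]_p) :
  dot v (B *m B^T *m v) = dot (B^T *m v) (B^T *m v).
Proof. by rewrite /dot trmx_mul trmxK !mulmxA. Qed.

(** * The smoothness constants of a permutation *)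

Section SmoothnessConstants.
Variables (R : realType) (d b m : nat).
Local Notation n := (b * m)%N.
Variables (a : 'I_n -> 'cV[R]_d) (L : 'I_n -> R) (s : 'S_n).
Hypothesis L_gt0 : forall i, 0 < L i.
Implicit Types (w : 'I_n -> R) (j : nat).

Definition tail_sum w j := \sum_(p < n | (b * j <= p)%N) w p *: a (s p).

Definition block_sum w j :=
  \sum_(p < n | (b * j <= p < b * j.+1)%N) w p *: a (s p).

Definition wnorm_sq w := \sum_p w p ^+ 2 / L (s p).

Lemma A_perm_mask (P : pred 'I_n) w :
  ((diag_mx (\row_p (P p)%:R) *m A_perm a s)^T *m \col_p w p : 'cV[R]_d)
  = \sum_(p | P p) w p *: a (s p).
Proof.
apply/matrixP => i j; rewrite ord1 {j} trmx_mul tr_diag_mx mxE summxE [RHS]big_mkcond.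
apply: eq_bigr => p _; rewrite mul_mx_diag !mxE.
by case: (P p); rewrite ?mulr1 ?mulr0 ?mul0r ?mxE // mulrC.
Qed.

(** Substituting [w p = sqrt (L (s p)) * u p] turns the left-hand side into a
    quadratic form in [u], and the weighted norm of [w] into the norm of [u].
    Both smoothness constants are instances, with batches or tails for [P]. *)
Lemma opnorm_masked_Gram (P : nat -> pred 'I_n) w :
  \sum_(j < m) dot (\sum_(p | P j p) w p *: a (s p)) (\sum_(p | P j p) w p *: a (s p))
  <= opnorm (sqrt_Lambda L s *m
       (\sum_(j < m) diag_mx (\row_p (P j p)%:R) *m A_perm a s *m (A_perm a s)^T
          *m diag_mx (\row_p (P j p)%:R)) *m sqrt_Lambda L s) * wnorm_sq w.
Proof.
set S := sqrt_Lambda L s; set G := (X in opnorm (_ *m X *m _)).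
pose u : 'cV[R]_n := \col_p (w p / Num.sqrt (L (s p))).
have Su : S *m u = \col_p w p.
  apply/matrixP => p q; rewrite ord1 mul_diag_mx !mxE mulrC divfK //.
  by rewrite gt_eqF // sqrtr_gt0.
have uu : dot u u = wnorm_sq w.
  rewrite dotE; apply: eq_bigr => p _; rewrite mxE -expr2 expr_div_n.
  by rewrite sqr_sqrtr // ltW.
rewrite -uu; apply: le_trans (dot_mulmx_le_opnorm _ _).
have -> : dot u (S *m G *m S *m u) = dot (\col_p w p) (G *m \col_p w p).
  by rewrite -Su /dot trmx_mul tr_diag_mx !mulmxA.
rewrite /G mulmx_suml dot_sumr ler_sum // => j _.
set D := diag_mx _.
have -> : D *m A_perm a s *m (A_perm a s)^T *m D
          = (D *m A_perm a s) *m (D *m A_perm a s)^T.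
  by rewrite trmx_mul tr_diag_mx !mulmxA.
by rewrite dot_mulmx_sym A_perm_mask.
Qed.

Hypotheses (b_gt0 : (0 < b)%N) (m_gt0 : (0 < m)%N).

Lemma block_sum_le_Ltilde w :
  \sum_(j < m) dot (block_sum w j) (block_sum w j)
  <= b%:R * Ltilde_perm a L s * wnorm_sq w.
Proof.
rewrite /Ltilde_perm mulrA divff ?mul1r ?pnatr_eq0 -?lt0n //.
exact: (opnorm_masked_Gram (fun j p => (b * j <= p < b * j.+1)%N)).
Qed.

Lemma tail_sum_le_Lhat w :
  \sum_(j < m) dot (tail_sum w j) (tail_sum w j)
  <= m%:R * n%:R * Lhat_perm a L s * wnorm_sq w.
Proof.
rewrite /Lhat_perm mulrA divff ?mul1r; last first.
  by rewrite -natrM pnatr_eq0 -lt0n !muln_gt0 m_gt0 b_gt0.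
exact: (opnorm_masked_Gram (fun j p => (b * j <= p)%N)).
Qed.

Lemma Lhat_perm_ge0 : 0 <= Lhat_perm a L s.
Proof. by rewrite mulr_ge0 ?opnorm_ge0 // invr_ge0 -natrM. Qed.

Lemma Ltilde_perm_ge0 : 0 <= Ltilde_perm a L s.
Proof. by rewrite mulr_ge0 ?opnorm_ge0 // invr_ge0. Qed.

Lemma Lhat_perm_le : Lhat_perm a L s <= Lhat a L.
Proof. exact: le_bigmax_cond. Qed.

Lemma Ltilde_perm_le : Ltilde_perm a L s <= Ltilde a L.
Proof. exact: le_bigmax_cond. Qed.

End SmoothnessConstants.

(** * The steps of the algorithm in closed form *)

(** [argmax] and [argmin] choose an arbitrary optimal point, so their value is
    known only where this point is unique. *)
Lemma argmax_eq disp (V : porderType disp) (T : pointedType) (F : T -> V) (x : T) :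
  (forall z, (F z <= F x)%O) -> (forall y, F y = F x -> y = x) -> argmax F = x.
Proof.
move=> Fx Fu; have H : [set y | forall z, (F z <= F y)%O] (argmax F).
  by apply: (@getPex _ [set y | forall z, (F z <= F y)%O]); exists x.
by apply: Fu; apply/le_anti; rewrite Fx H.
Qed.

Lemma argmin_eq disp (V : porderType disp) (T : pointedType) (F : T -> V) (x : T) :
  (forall z, (F x <= F z)%O) -> (forall y, F y = F x -> y = x) -> argmin F = x.
Proof.
move=> Fx Fu; have H : [set y | forall z, (F y <= F z)%O] (argmin F).
  by apply: (@getPex _ [set y | forall z, (F y <= F z)%O]); exists x.
by apply: Fu; apply/le_anti; rewrite Fx H.
Qed.

Lemma convex_conjugate_ge (R : realType) (f : R -> R) (y x : R) :
  ((y * x - f x)%:E <= convex_conjugate f y)%E.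
Proof. by apply: ereal_sup_ubound; exists x. Qed.

Lemma convex_conjugate_derive (R : realType) (L : R) (f : R -> R) (z : R) :
  convex_function [set: convex_lmodType R^o] f -> L_smooth L f ->
  convex_conjugate f (derive1 f z) = (derive1 f z * z - f z)%:E.
Proof.
move=> cf Lf; apply/le_anti; rewrite convex_conjugate_ge andbT.
apply: ge_ereal_sup => _ [x _ <-]; rewrite lee_fin.
have := convex_ge_tangent cf Lf z x; lra.
Qed.

Lemma derive_of_conjugate_max (R : realType) (L : R) (f : R -> R) (y z : R) :
  L_smooth L f -> (forall x, y * x - f x <= y * z - f z) -> y = derive1 f z.
Proof.
move=> Lf H.
have key t : (y - derive1 f z) * t <= L / 2 * t ^+ 2.
  have := smooth_quadratic_bound Lf z (z + t).
  have := H (z + t); rewrite ler_norml addrAC subrr add0r => ? /andP[_]; lra.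
apply/eqP; rewrite -subr_eq0 eq_le; apply/andP; split.
  exact: (@linear_le_quadratic _ _ (L / 2)) => t _.
rewrite -oppr_le0; apply: (@linear_le_quadratic _ _ (L / 2)) => t _.
by have := key (- t); rewrite sqrrN mulrN mulNr.
Qed.

Section Steps.
Variables (R : realType) (d b m : nat).
Local Notation n := (b * m)%N.
Variables (a : 'I_n -> 'cV[R]_d) (ell : 'I_n -> R -> R) (L : 'I_n -> R).
Hypothesis ell_cvx : forall i, convex_function [set: convex_lmodType R^o] (ell i).
Hypothesis ell_smooth : forall i, L_smooth (L i) (ell i).
Variables (s : 'S_n) (i : 'I_m).
Hypothesis b_gt0 : (0 < b)%N.

Lemma A_batchE (x : 'cV[R]_d) (j : 'I_b) :
  (A_batch a s i *m x) j 0 = dot (a (s (batch_pos i j))) x.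
Proof. by rewrite mxE dotE; apply: eq_bigr => c _; rewrite !mxE. Qed.

(** By the Fenchel-Young inequality the dual objective is at most the sum of the
    losses, and it reaches this value at the vector of derivatives only. *)
Lemma dual_stepE (x : 'cV[R]_d) :
  dual_step a ell s i x =
  \col_j derive1 (ell (s (batch_pos i j))) (dot (a (s (batch_pos i j))) x).
Proof.
pose e j := ell (s (batch_pos i j)); pose z j := dot (a (s (batch_pos i j))) x.
have lin (y : 'cV[R]_b) :
    (y^T *m A_batch a s i *m x) 0 0 = \sum_j y j 0 * z j.
  rewrite -mulmxA mxE; apply: eq_bigr => j _.
  by rewrite mxE A_batchE.
have ge (y : 'cV[R]_b) (t : 'I_b -> R) :
    ((\sum_j (y j 0 * t j - e j (t j)))%R%:E
      <= \sum_j convex_conjugate (e j) (y j 0%R))%E.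
  by rewrite -sumEFin; apply: lee_sum => j _; exact: convex_conjugate_ge.
pose dz : 'cV[R]_b := \col_j derive1 (e j) (z j).
have opt : (((dz^T *m A_batch a s i *m x) 0 0)%R%:E
   - \sum_j convex_conjugate (e j) (dz j 0%R))%E = (\sum_j e j (z j))%:E.
  under [X in (_ - X)%E]eq_bigr => j _ do
    rewrite mxE (convex_conjugate_derive _ (ell_cvx _) (ell_smooth _)).
  rewrite lin sumEFin -EFinB -sumrB; congr EFin; apply: eq_bigr => j _.
  by rewrite mxE /e; ring.
apply: argmax_eq => [y|y]; rewrite opt.
  rewrite lin; apply: (@le_trans _ _
    ((\sum_j y j 0 * z j)%R%:E - (\sum_j (y j 0 * z j - e j (z j)))%R%:E)%E).
    exact: leeB (ge _ _).
  rewrite -EFinB lee_fin -sumrB ler_sum // => j _; lra.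
(* At a maximizer all the Fenchel-Young inequalities are tight; freeing the
   [j]-th one shows that [z j] maximizes the supremum defining the conjugate. *)
rewrite lin => E; apply/matrixP => j k; rewrite ord1 mxE {k}.
apply: (derive_of_conjugate_max (ell_smooth _)) => t.
have := ge y (fun k => if k == j then t else z k).
move: E; case: (\sum_j convex_conjugate _ _)%E => [c| |] //.
rewrite -EFinB => -[E]; rewrite lee_fin => H.
have {}H : \sum_k (y k 0 * (if k == j then t else z k)
     - e k (if k == j then t else z k)) <= \sum_k (y k 0 * z k - e k (z k)).
  by apply: le_trans H _; rewrite sumrB -E; lra.
move: H; rewrite (bigD1 j) //= [leRHS](bigD1 j) //= eqxx.
under eq_bigr => k /negbTE -> do [].
by rewrite lerD2r.
Qed.

Lemma batch_pos_reindex (V : nmodType) (F : 'I_n -> V) :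
  \sum_(j < b) F (batch_pos i j) = \sum_(p < n | (b * i <= p < b * i.+1)%N) F p.
Proof.
rewrite [RHS](reindex (batch_pos i)) /=.
  apply: eq_bigl => j; rewrite leq_addr mulnS addnC ltn_add2r ltn_ord //.
exists (fun p : 'I_n => Ordinal (ltn_pmod (p - b * i) b_gt0)) => [j _|p].
  by apply/val_inj; rewrite /= addKn modn_small.
rewrite inE => /andP[p1 p2]; apply/val_inj => /=.
by rewrite modn_small ?subnKC // ltn_subLR // -mulnSr.
Qed.

(** The proximal objective is a constant plus [b / (2 * eta)] times the squared
    distance to the gradient step. *)
Lemma primal_stepE (eta : R) (x : 'cV[R]_d) : 0 < eta ->
  primal_step a ell eta s i x =
  x - (eta / b%:R) *:
    block_sum a s (fun p => derive1 (ell (s p)) (dot (a (s p)) x)) i.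
Proof.
move=> eta0; set g := block_sum _ _ _ _.
have b0 : (0 : R) < b%:R by rewrite ltr0n.
have lin (z : 'cV[R]_d) :
    ((dual_step a ell s i x)^T *m A_batch a s i *m z) 0 0 = dot g z.
  rewrite -mulmxA mxE /g /block_sum dot_suml -batch_pos_reindex.
  by apply: eq_bigr => j _; rewrite A_batchE mxE dual_stepE mxE dotZl.
have E (z : 'cV[R]_d) : dot g z + b%:R / (2 * eta) * l2norm (z - x) ^+ 2
    = dot g x - eta / (2 * b%:R) * dot g g
      + b%:R / (2 * eta) * dot (z - (x - (eta / b%:R) *: g))
                               (z - (x - (eta / b%:R) *: g)).
  have -> : z - (x - (eta / b%:R) *: g) = (z - x) + (eta / b%:R) *: g.
    by rewrite opprB addrCA addrC.
  rewrite l2norm_sqr {1}(_ : z = x + (z - x)); last by rewrite addrC subrK.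
  move: (z - x) => h; rewrite !dotDr !dotDl !dotZr !dotZl (dotC h g).
  by field; rewrite !gt_eqF.
have c0 : 0 < b%:R / (2 * eta) by rewrite divr_gt0 // mulr_gt0.
apply: argmin_eq => [z|y]; rewrite !lin !E subrr dot0r mulr0 addr0.
  by rewrite lerDl mulr_ge0 ?dot_ge0 // ltW.
rewrite -[RHS]addr0 => /addrI/eqP; rewrite mulf_eq0 gt_eqF //= => /eqP.
by move/dot_eq0/subr0_eq.
Qed.

End Steps.

(** A step of length [t] from the minimizer against the gradient changes the sum
    of the losses by at most a multiple of [t ^+ 2] minus [t] times the squared
    norm of the gradient. *)
Lemma gradient_at_minimizer (R : realType) (n d : nat) (a : 'I_n -> 'cV[R]_d)
    (ell : 'I_n -> R -> R) (L : 'I_n -> R) (xs : 'cV[R]_d) :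
  (0 < n)%N -> (forall i, L_smooth (L i) (ell i)) ->
  (forall x, objective a ell xs <= objective a ell x) ->
  \sum_i derive1 (ell i) (dot (a i) xs) *: a i = 0.
Proof.
move=> n0 Ls xmin; set g := \sum_i _; apply: dot_eq0.
apply/le_anti; rewrite dot_ge0 andbT.
apply: (@linear_le_quadratic _ _ (\sum_i L i / 2 * dot (a i) g ^+ 2)) => t t0.
have := xmin (xs - t *: g); rewrite /objective ler_pM2l ?invr_gt0 ?ltr0n // => H.
have : \sum_i ell i (dot (a i) (xs - t *: g)) <= \sum_i ell i (dot (a i) xs)
   + (\sum_i (- (t * (derive1 (ell i) (dot (a i) xs) * dot (a i) g)))
      + (\sum_i L i / 2 * dot (a i) g ^+ 2) * t ^+ 2).
  rewrite mulr_suml -!big_split /= ler_sum // => i _.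
  have := smooth_quadratic_bound (Ls i) (dot (a i) xs) (dot (a i) (xs - t *: g)).
  rewrite ler_norml => /andP[_].
  have -> : dot (a i) (xs - t *: g) - dot (a i) xs = - (t * dot (a i) g).
    by rewrite dotBr dotZr; ring.
  rewrite sqrrN exprMn; lra.
have -> : \sum_i (- (t * (derive1 (ell i) (dot (a i) xs) * dot (a i) g)))
   = - (t * dot g g).
  rewrite sumrN -mulr_sumr {3}/g dot_suml; congr (- (_ * _)).
  by apply: eq_bigr => i _; rewrite dotZl.
by rewrite mulrC; lra.
Qed.

(** * One epoch *)

(** Squared form of the step-size restriction, which also covers the case of a
    zero denominator. *)
Lemma step_bound_sqr (R : realType) (d b m : nat) (a : 'I_(b * m) -> 'cV[R]_d)
    (L : 'I_(b * m) -> R) (s : 'S_(b * m)) (eta : R) :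
  (0 < b * m)%N -> 0 < eta ->
  (eta%:E <= step_bound a L s)%E <->
  eta ^+ 2 * (b * m)%:R ^+ 2 * (2 * Lhat_perm a L s * Ltilde_perm a L s) <= b%:R ^+ 2.
Proof.
move=> n0 eta0; rewrite /step_bound.
set Q := 2 * _ * _.
have Q0 : 0 <= Q.
  exact: mulr_ge0 (mulr_ge0 (ler0n _ _) (Lhat_perm_ge0 _ _ _)) (Ltilde_perm_ge0 _ _ _).
have n0' : (0 : R) < (b * m)%:R by rewrite ltr0n.
case: ifPn => [|D0].
  rewrite mulf_eq0 gt_eqF //= sqrtr_eq0 => Qle.
  have -> : Q = 0 by apply/le_anti; rewrite Qle Q0.
  by rewrite mulr0; split => _; rewrite ?sqr_ge0 ?leey.
have D1 : 0 < (b * m)%:R * Num.sqrt Q.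
  by rewrite lt_neqAle eq_sym D0 mulr_ge0 ?sqrtr_ge0 // ltW.
rewrite lee_fin ler_pdivlMr // -ler_sqr ?nnegrE ?ler0n //; last first.
  by rewrite mulr_ge0 // ltW.
by rewrite !exprMn sqr_sqrtr // mulrA.
Qed.

Lemma sum_dot_young (R : realType) (I : finType) (p : nat)
    (B D T : I -> 'cV[R]_p) (al : R) : 0 < al ->
  - (\sum_j dot (B j) (D j + T j)) <=
  al * (\sum_j dot (B j) (B j)) + al^-1 / 2 * (\sum_j dot (D j) (D j))
  + al^-1 / 2 * (\sum_j dot (T j) (T j)).
Proof.
move=> al0; rewrite -sumrN !mulr_sumr -!big_split; apply: ler_sum => j _ /=.
have := dot_le_young (- B j) (D j) al0.
have := dot_le_young (- B j) (T j) al0.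
rewrite dotDr !dotNl !dotNr opprK; lra.
Qed.

Section Epoch.
Variables (R : realType) (d b m : nat).
Local Notation n := (b * m)%N.
Variables (a : 'I_n -> 'cV[R]_d) (ell : 'I_n -> R -> R) (L : 'I_n -> R).
Hypothesis L_gt0 : forall i, 0 < L i.
Hypothesis ell_cvx : forall i, convex_function [set: convex_lmodType R^o] (ell i).
Hypothesis ell_smooth : forall i, L_smooth (L i) (ell i).
Hypotheses (b_gt0 : (0 < b)%N) (m_gt0 : (0 < m)%N).
Variables (s : 'S_n) (eta : R) (x xs : 'cV[R]_d).
Hypothesis eta_gt0 : 0 < eta.

Lemma in_block (p : 'I_n) (j : nat) :
  (b * j <= p < b * j.+1)%N = (p %/ b == j)%N.
Proof.
rewrite [RHS]eqn_leq [RHS]andbC leq_divRL // -[(p %/ b <= j)%N]ltnS ltn_divLR //.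
by rewrite !(mulnC _ b).
Qed.

Lemma batch_index_lt (p : 'I_n) : (p %/ b < m)%N.
Proof. by rewrite ltn_divLR // (mulnC m). Qed.

Lemma sum_over_blocks (V : nmodType) (F : 'I_n -> V) :
  \sum_p F p = \sum_(j < m) \sum_(p < n | (b * j <= p < b * j.+1)%N) F p.
Proof.
rewrite (partition_big (fun p => Ordinal (batch_index_lt p)) predT) //=.
by apply: eq_bigr => j _; apply: eq_bigl => p; rewrite in_block.
Qed.

Lemma tail_sumS (w : 'I_n -> R) (j : nat) :
  tail_sum a s w j = block_sum a s w j + tail_sum a s w j.+1.
Proof.
rewrite /tail_sum (bigID (fun p : 'I_n => (p < b * j.+1)%N)) /=; congr (_ + _).
apply: eq_bigl => p; rewrite -leqNgt andb_idl // => /(leq_trans _) -> //.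
by rewrite leq_mul2l leqnSn orbT.
Qed.

Lemma tail_sum_all (w : 'I_n -> R) : tail_sum a s w 0 = \sum_p w p *: a (s p).
Proof. by apply: eq_bigl => p; rewrite muln0. Qed.

Lemma tail_sum_none (w : 'I_n -> R) : tail_sum a s w m = 0.
Proof. by rewrite /tail_sum big_pred0 // => p; rewrite leqNgt ltn_ord. Qed.

Lemma tail_sumD (v w : 'I_n -> R) (j : nat) :
  tail_sum a s v j = tail_sum a s (fun p => v p - w p) j + tail_sum a s w j.
Proof.
by rewrite /tail_sum -big_split /=; apply: eq_bigr => p _; rewrite -scalerDl subrK.
Qed.

Definition batch_iterate (k : nat) : 'cV[R]_d :=
  foldl (fun z i => primal_step a ell eta s i z) x (take k (enum 'I_m)).

Lemma batch_iterate_epoch : batch_iterate m = epoch a ell eta s x.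
Proof. by rewrite /batch_iterate take_oversize // size_enum_ord. Qed.

(** The concatenation of the dual steps of the epoch. *)
Definition dual_iterate (p : 'I_n) : R :=
  derive1 (ell (s p)) (dot (a (s p)) (batch_iterate (p %/ b))).

Definition derivs_at (z : 'cV[R]_d) (p : 'I_n) : R :=
  derive1 (ell (s p)) (dot (a (s p)) z).

Lemma batch_iterateS (j : nat) : (j < m)%N ->
  batch_iterate j.+1 =
  batch_iterate j - (eta / b%:R) *: block_sum a s dual_iterate j.
Proof.
move=> jm; rewrite {1}/batch_iterate (take_nth (Ordinal jm)) ?size_enum_ord //.
rewrite -cats1 foldl_cat (nth_ord_enum _ (Ordinal jm)).
apply: etrans (primal_stepE a ell_cvx ell_smooth s (Ordinal jm) b_gt0 _ eta_gt0) _.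
rewrite -/(batch_iterate j); congr (_ - _ *: _).
apply: eq_bigr => p; rewrite in_block => /eqP pj.
by rewrite /dual_iterate pj.
Qed.

Lemma batch_iterate_last (j : nat) : (j <= m)%N ->
  batch_iterate m - batch_iterate j = - (eta / b%:R) *: tail_sum a s dual_iterate j.
Proof.
move=> jm; rewrite -(subKn jm); elim: (m - j)%N {jm} (leq_subr j m) => [|k IH] km.
  by rewrite subn0 subrr tail_sum_none scaler0.
have jm : (m - k.+1 < m)%N by rewrite ltn_subrL.
have E : (m - k.+1).+1 = (m - k)%N by rewrite subnSK.
rewrite tail_sumS E scalerDr -IH ?(ltnW km) // -E (batch_iterateS jm).
by rewrite scaleNr opprB addrCA addKr.
Qed.

Local Notation Lhs := (Lhat_perm a L s).
Local Notation Lts := (Ltilde_perm a L s).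
Local Notation v := (derivs_at (batch_iterate m)).
Local Notation y := dual_iterate.
Local Notation ys := (derivs_at xs).

(** The primal-dual gap estimate, one loss at a time: cocoercivity is used
    between the last iterate and the iterate of the batch, then between the
    latter and the minimizer.  The two squared terms are what pays for the cross
    terms of the epoch. *)
Lemma loss_gap_le (p : 'I_n) :
  ell (s p) (dot (a (s p)) (batch_iterate m)) - ell (s p) (dot (a (s p)) xs) <=
  (v p - y p) * dot (a (s p)) (batch_iterate m - batch_iterate (p %/ b))
  + dot (y p *: a (s p)) (batch_iterate m - xs)
  - 2^-1 * ((v p - y p) ^+ 2 / L (s p)) - 2^-1 * ((y p - ys p) ^+ 2 / L (s p)).
Proof.
set zm := batch_iterate m; set z := batch_iterate (p %/ b).
have := convex_smooth_cocoercive (L_gt0 (s p)) (ell_cvx (s p)) (ell_smooth (s p))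
  (dot (a (s p)) zm) (dot (a (s p)) z).
have := convex_smooth_cocoercive (L_gt0 (s p)) (ell_cvx (s p)) (ell_smooth (s p))
  (dot (a (s p)) z) (dot (a (s p)) xs).
rewrite -/(dual_iterate p) -/(derivs_at xs p) -/(derivs_at zm p).
rewrite dotZl !dotBr !invfM; lra.
Qed.

(** The vector on the left is a multiple of the total displacement of the epoch,
    so the scalar product is a difference of squared distances, up to the
    squared length of the displacement. *)
Lemma three_point_le :
  dot (\sum_p y p *: a (s p)) (batch_iterate m - xs) <=
  b%:R / (2 * eta) * (dot (x - xs) (x - xs)
     - dot (batch_iterate m - xs) (batch_iterate m - xs)).
Proof.
have b0 : (0 : R) < b%:R by rewrite ltr0n.
have := batch_iterate_last (leq0n m); rewrite tail_sum_all.
have -> : batch_iterate 0 = x by rewrite /batch_iterate take0.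
set zm := batch_iterate m; set g := \sum_p _ => E.
have -> : x - xs = (zm - xs) + (eta / b%:R) *: g.
  by rewrite -[_ *: g]opprK -scaleNr -E opprB [RHS]addrC subrKA.
move: (zm - xs) => h.
rewrite [dot (h + _) _]dotDr !dotDl !dotZr !dotZl (dotC h g).
set q := dot g h; set r := dot h h.
have -> : b%:R / (2 * eta) * (r + eta / b%:R * q
   + (eta / b%:R * q + eta / b%:R * (eta / b%:R * dot g g)) - r)
   = q + eta / (2 * b%:R) * dot g g by field; rewrite !gt_eqF.
by rewrite lerDl mulr_ge0 ?dot_ge0 // divr_ge0 // ltW // mulr_gt0.
Qed.

(** Young's inequality with parameter [1 / (2 * eta * Ltilde)], applied after
    splitting the dual iterate as a deviation from the optimal dual vector plus
    that vector.  The first two terms of the bound are absorbed by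
    [loss_gap_le]; the step-size restriction is what makes the second one fit. *)
Lemma cross_terms_le :
  eta ^+ 2 * n%:R ^+ 2 * (2 * Lhs * Lts) <= b%:R ^+ 2 ->
  \sum_p (v p - y p) * dot (a (s p)) (batch_iterate m - batch_iterate (p %/ b)) <=
  2^-1 * wnorm_sq L s (fun p => v p - y p)
  + 2^-1 * wnorm_sq L s (fun p => y p - ys p)
  + eta ^+ 2 * Lts / b%:R
    * \sum_(j < m) dot (tail_sum a s ys j) (tail_sum a s ys j).
Proof.
move=> step; have b0 : (0 : R) < b%:R by rewrite ltr0n.
set V := wnorm_sq L s _; set W := wnorm_sq L s _; set Phi := \sum_(j < m) _.
have wnorm_ge0 w : 0 <= wnorm_sq L s w.
  by apply: sumr_ge0 => p _; rewrite divr_ge0 ?sqr_ge0 // ltW.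
have Phi0 : 0 <= Phi by apply: sumr_ge0 => j _; exact: dot_ge0.
pose B j := block_sum a s (fun p => v p - y p) j.
have -> : \sum_p (v p - y p) * dot (a (s p)) (batch_iterate m - batch_iterate (p %/ b))
   = \sum_(j < m) - (eta / b%:R) * dot (B j) (tail_sum a s y j).
  rewrite sum_over_blocks; apply: eq_bigr => j _.
  rewrite /B dot_suml mulr_sumr; apply: eq_bigr => p; rewrite in_block => /eqP ->.
  by rewrite (batch_iterate_last (ltnW (ltn_ord j))) dotZr dotZl mulrCA.
pose D j := tail_sum a s (fun p => y p - ys p) j.
have BB : \sum_(j < m) dot (B j) (B j) <= b%:R * Lts * V.
  exact: block_sum_le_Ltilde.
have TT : \sum_(j < m) dot (D j) (D j) <= m%:R * n%:R * Lhs * W.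
  exact: tail_sum_le_Lhat.
have Lt0 := Ltilde_perm_ge0 a L s.
(* The parameter of Young's inequality needs a nonzero [Ltilde]; if [Ltilde] is
   zero, all the batch sums of [v - y] vanish. *)
have [Lts0|Ltsn] := eqVneq Lts 0.
  rewrite big1 => [|j _].
    rewrite Lts0 mulr0 !mul0r addr0.
    by apply: addr_ge0; apply: mulr_ge0 => //; exact: wnorm_ge0.
  have -> : B j = 0; last by rewrite dot0l mulr0.
  apply: dot_eq0; apply/le_anti; rewrite dot_ge0 andbT.
  move: BB; rewrite Lts0 mulr0 mul0r; apply: le_trans.
  rewrite (bigD1 j) //= lerDl sumr_ge0 // => k _; exact: dot_ge0.
have Ltp : 0 < Lts by rewrite lt_neqAle eq_sym Ltsn.
have [al al0 alE] : exists2 al : R, 0 < al & al = (2 * eta * Lts)^-1.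
  exists (2 * eta * Lts)^-1 => //; rewrite invr_gt0.
  by apply: mulr_gt0 => //; apply: mulr_gt0.
have -> : \sum_(j < m) - (eta / b%:R) * dot (B j) (tail_sum a s y j)
   = eta / b%:R * - \sum_(j < m) dot (B j) (D j + tail_sum a s ys j).
  rewrite mulrN -mulNr mulr_sumr; apply: eq_bigr => j _.
  by rewrite (tail_sumD y ys).
apply: le_trans (ler_wpM2l _ (sum_dot_young _ _ _ al0)) _.
  by rewrite divr_ge0 // ltW.
rewrite -/Phi; move: BB TT.
set SB := \sum_(j < m) dot (B j) (B j); set ST := \sum_(j < m) dot (D j) (D j).
move=> BB TT.
have e1 : eta / b%:R * (al * SB) <= 2^-1 * V.
  rewrite mulrA; apply: le_trans (ler_wpM2l _ BB) _.
    by rewrite mulr_ge0 ?divr_ge0 // ltW.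
  have -> : eta / b%:R * al * (b%:R * Lts * V) = 2^-1 * V.
    by rewrite alE; field; rewrite !gt_eqF.
  exact: lexx.
have e2 : eta / b%:R * (al^-1 / 2 * ST) <= 2^-1 * W.
  rewrite mulrA; apply: le_trans (ler_wpM2l _ TT) _.
    by rewrite !mulr_ge0 ?invr_ge0 // ltW.
  have -> : eta / b%:R * (al^-1 / 2) * (m%:R * n%:R * Lhs * W)
    = 2^-1 * W * ((eta ^+ 2 * n%:R ^+ 2 * (2 * Lhs * Lts)) / b%:R ^+ 2).
    by rewrite alE invrK natrM; field; rewrite !gt_eqF.
  rewrite -[leRHS]mulr1 ler_wpM2l ?mulr_ge0 ?wnorm_ge0 //.
  by rewrite ler_pdivrMr ?mul1r // exprn_gt0.
have e3 : eta / b%:R * (al^-1 / 2 * Phi) = eta ^+ 2 * Lts / b%:R * Phi.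
  by rewrite alE invrK; field; rewrite !gt_eqF.
rewrite !mulrDr -e3; lra.
Qed.

Lemma epoch_descent :
  eta ^+ 2 * n%:R ^+ 2 * (2 * Lhs * Lts) <= b%:R ^+ 2 ->
  eta * (objective a ell (epoch a ell eta s x) - objective a ell xs) <=
  b%:R / (2 * n%:R) * (l2norm (x - xs) ^+ 2 - l2norm (epoch a ell eta s x - xs) ^+ 2)
  + eta ^+ 3 * Lts / (b%:R * n%:R)
    * \sum_(j < m) dot (tail_sum a s ys j) (tail_sum a s ys j).
Proof.
move=> step; set Phi := \sum_(j < m) _.
have b0 : (0 : R) < b%:R by rewrite ltr0n.
have n0 : (0 : R) < n%:R by rewrite ltr0n muln_gt0 b_gt0.
rewrite -batch_iterate_epoch !l2norm_sqr; set zm := batch_iterate m.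
have -> : objective a ell zm - objective a ell xs = n%:R^-1 *
   \sum_p (ell (s p) (dot (a (s p)) zm) - ell (s p) (dot (a (s p)) xs)).
  rewrite /objective -mulrBr -sumrB; congr (_ * _).
  by rewrite (reindex_inj (@perm_inj _ s)).
set S := \sum_p _; set D := dot (x - xs) _ - _.
have H : S <= b%:R / (2 * eta) * D + eta ^+ 2 * Lts / b%:R * Phi.
  apply: le_trans (ler_sum _ (fun p _ => loss_gap_le p)) _.
  rewrite 2!sumrB big_split /= -!mulr_sumr -dot_suml.
  have := cross_terms_le step; have := three_point_le.
  rewrite -/zm -/Phi -/D /wnorm_sq.
  set C := \sum_p (_ * dot _ _); set G := dot (\sum_p _) _; lra.
have c0 : 0 <= eta / n%:R by rewrite divr_ge0 // ltW.
have -> : eta * (n%:R^-1 * S) = eta / n%:R * S by rewrite mulrA.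
apply: le_trans (ler_wpM2l c0 H) _.
have -> : eta / n%:R * (b%:R / (2 * eta) * D + eta ^+ 2 * Lts / b%:R * Phi)
  = b%:R / (2 * n%:R) * D + eta ^+ 3 * Lts / (b%:R * n%:R) * Phi.
  by move: b0 n0; move: (n%:R) (b%:R) => N B b0 n0; field; rewrite !gt_eqF.
exact: lexx.
Qed.

End Epoch.

(** * Partial sums along a uniformly random permutation *)

Section RandomPermutation.
Variables (R : realType) (d n : nat) (c : 'I_n -> 'cV[R]_d).
Hypothesis c_sum0 : \sum_q c q = 0.

Definition perm_corr (p q : 'I_n) : R := \sum_(s : 'S_n) dot (c (s p)) (c (s q)).

(** Relabelling the positions by a fixed permutation does not change the sum
    over all permutations. *)
Lemma perm_corr_perm (t : 'S_n) (p q : 'I_n) :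
  perm_corr (t p) (t q) = perm_corr p q.
Proof.
rewrite /perm_corr [RHS](reindex_inj (mulgI t)).
by apply: eq_bigr => s _; rewrite !permM.
Qed.

Lemma perm_corr_diag (p : 'I_n) :
  n%:R * perm_corr p p = n`!%:R * \sum_q dot (c q) (c q).
Proof.
have -> : n%:R * perm_corr p p = \sum_(q < n) perm_corr q q.
  have E q : perm_corr q q = perm_corr p p.
    by rewrite -(perm_corr_perm (tperm p q)) tpermR.
  by rewrite (eq_bigr _ (fun q _ => E q)) sumr_const card_ord mulr_natl.
rewrite exchange_big /=.
have E (s : 'S_n) : \sum_q dot (c (s q)) (c (s q)) = \sum_q dot (c q) (c q).
  by rewrite [RHS](reindex_inj (@perm_inj _ s)).
by rewrite (eq_bigr _ (fun s _ => E s)) sumr_const card_Sn mulr_natl.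
Qed.

(** The correlations of position [p] with all the positions sum to zero because
    the vectors do, and those with the other positions are all equal. *)
Lemma perm_corr_offdiag (p q : 'I_n) : p != q ->
  (n%:R - 1) * perm_corr p q = - perm_corr p p.
Proof.
move=> pq; have n_gt0 : (0 < n)%N by apply: leq_ltn_trans (ltn_ord p).
have : \sum_q' perm_corr p q' = 0.
  rewrite exchange_big big1 // => s _; rewrite -dot_sumr.
  suff -> : \sum_q0 c (s q0) = 0 by rewrite dot0r.
  by rewrite -[RHS]c_sum0 [RHS](reindex_perm s).
rewrite (bigD1 p) //= => /eqP; rewrite addrC addr_eq0 => /eqP <-.
have E q' : q' != p -> perm_corr p q' = perm_corr p q.
  move=> q'p; rewrite -(perm_corr_perm (tperm q' q) p q') tpermL tpermD //.
  by rewrite eq_sym.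
rewrite (eq_bigr _ E) sumr_const cardC1 card_ord -[RHS]mulr_natl.
by rewrite -subn1 natrB.
Qed.

(** The second moment of a centered sample without replacement: by symmetry only
    the two correlations above occur among the pairs of positions in [P]. *)
Lemma sum_perm_sqr_partial (P : pred 'I_n) : (1 < n)%N ->
  n%:R * (n%:R - 1) *
    \sum_(s : 'S_n) dot (\sum_(p | P p) c (s p)) (\sum_(p | P p) c (s p))
  = n`!%:R * (#|P|%:R * (n%:R - #|P|%:R)) * \sum_q dot (c q) (c q).
Proof.
move=> n1; set S := \sum_q dot (c q) (c q).
have -> : \sum_(s : 'S_n) dot (\sum_(p | P p) c (s p)) (\sum_(p | P p) c (s p))
   = \sum_(p | P p) \sum_(q | P q) perm_corr p q.
  under eq_bigr => s _ do rewrite dot_suml.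
  rewrite exchange_big; apply: eq_bigr => p _.
  by under eq_bigr => s _ do rewrite dot_sumr; rewrite exchange_big.
have E p : P p -> n%:R * (n%:R - 1) * (\sum_(q | P q) perm_corr p q)
   = n`!%:R * (n%:R - #|P|%:R) * S.
  move=> Pp; rewrite (bigD1 p) //= mulrDr [X in _ + X]mulr_sumr.
  have F q : P q && (q != p) ->
      n%:R * (n%:R - 1) * perm_corr p q = - (n`!%:R * S).
    move=> /andP[_ qp]; rewrite -mulrA perm_corr_offdiag 1?eq_sym //.
    by rewrite mulrN perm_corr_diag.
  rewrite (eq_bigr (fun=> - (n`!%:R * S))); last exact: F.
  rewrite sumr_const -[#|_|]/(#|[pred q | P q && (q != p)]|).
  have -> : #|[pred q | P q && (q != p)]| = #|P|.-1.
    rewrite (cardD1 p P) -topredE /= Pp add1n /=; apply: eq_card => q.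
    by rewrite !inE andbC.
  have P0 : (0 < #|P|)%N by apply/card_gt0P; exists p.
  rewrite mulrAC perm_corr_diag -/S -[X in _ + X]mulr_natl -subn1 natrB //; ring.
rewrite mulr_sumr (eq_bigr (fun=> n`!%:R * (n%:R - #|P|%:R) * S)); last exact: E.
rewrite sumr_const -[LHS]mulr_natl; ring.
Qed.

End RandomPermutation.

Lemma sum_ord_mul_rev (R : realType) (m : nat) :
  6 * \sum_(j < m) ((m%:R - j%:R) * j%:R) = m%:R * (m%:R ^+ 2 - 1) :> R.
Proof.
have sum1 : 2 * \sum_(j < m) j%:R = m%:R * (m%:R - 1) :> R.
  elim: m => [|m IH]; first by rewrite big_ord0 mulr0 mul0r.
  by rewrite big_ord_recr /= mulrDr IH -natr1; ring.
have sum2 : 6 * \sum_(j < m) j%:R ^+ 2 = m%:R * (m%:R - 1) * (2 * m%:R - 1) :> R.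
  elim: m {sum1} => [|m IH]; first by rewrite big_ord0 mulr0 !mul0r.
  by rewrite big_ord_recr /= mulrDr IH -natr1; ring.
under eq_bigr => j _ do rewrite mulrBl -expr2.
rewrite sumrB -mulr_sumr mulrBr sum2.
have -> : 6 * (m%:R * \sum_(j < m) j%:R) = 3 * m%:R * (2 * \sum_(j < m) j%:R) :> R.
  by ring.
rewrite sum1; ring.
Qed.

(** The tail of index [j] is a sample of size [b * m - b * j], hence the sum over
    [j] is a multiple of [\sum_j (m - j) * j]. *)
Lemma mean_tail_sums (R : realType) (d b m : nat) (a : 'I_(b * m) -> 'cV[R]_d)
    (ell : 'I_(b * m) -> R -> R) (xs : 'cV[R]_d) :
  (1 < b * m)%N ->
  \sum_i derive1 (ell i) (dot (a i) xs) *: a i = 0 ->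
  (b * m)`!%:R^-1 * \sum_(s : 'S_(b * m)) \sum_(j < m)
    dot (tail_sum a s (derivs_at a ell s xs) j) (tail_sum a s (derivs_at a ell s xs) j)
  = (b * m)%:R * ((b * m)%:R - b%:R) * ((b * m)%:R + b%:R)
    / (6 * b%:R * ((b * m)%:R - 1)) * sigma_sq a ell xs.
Proof.
move=> n1 grad0; set n := (b * m)%N.
have n0 : (0 < n)%N by exact: ltnW.
have b0 : (0 < b)%N by move: n0; rewrite muln_gt0 => /andP[].
have b0' : b%:R != 0 :> R by rewrite pnatr_eq0 -lt0n.
have n0' : n%:R != 0 :> R by rewrite pnatr_eq0 -lt0n.
have n1' : n%:R - 1 != 0 :> R by rewrite subr_eq0 -[1]/(1%:R) eqr_nat gtn_eqF.
have nf : n`!%:R != 0 :> R by rewrite pnatr_eq0 -lt0n fact_gt0.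
have nE : n%:R = b%:R * m%:R :> R by rewrite natrM.
pose c q := derive1 (ell q) (dot (a q) xs) *: a q.
set S := \sum_q dot (c q) (c q).
have -> : sigma_sq a ell xs = n%:R^-1 * S.
  congr (_ * _); apply: eq_bigr => q _.
  by rewrite l2norm_sqr /c dotZl dotZr mulrA expr2.
have E (j : 'I_m) : \sum_(s : 'S_n) dot (tail_sum a s (derivs_at a ell s xs) j)
     (tail_sum a s (derivs_at a ell s xs) j)
   = n`!%:R * b%:R ^+ 2 * S / (n%:R * (n%:R - 1)) * ((m%:R - j%:R) * j%:R).
  have bjn : (b * j <= n)%N by rewrite /n leq_mul2l (ltnW (ltn_ord j)) orbT.
  have := sum_perm_sqr_partial grad0 (fun p => b * j <= p)%N n1.
  rewrite -/S; set X := \sum_(s : 'S_n) _.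
  have -> : #|(fun p : 'I_n => b * j <= p)%N| = (n - b * j)%N.
    rewrite -sum1_card -[RHS]muln1 -sum_nat_const_nat.
    by rewrite (big_geq_mkord _ _ xpredT (fun=> 1%N)).
  rewrite natrB; last exact: bjn.
  have nn : n%:R * (n%:R - 1) != 0 :> R by rewrite mulf_neq0.
  move=> /(canRL (mulKf nn)) ->.
  rewrite -/n natrM.
  have -> : (n%:R - b%:R * j%:R) * (n%:R - (n%:R - b%:R * j%:R))
    = b%:R ^+ 2 * ((m%:R - j%:R) * j%:R) :> R by rewrite nE; ring.
  by field; rewrite n0' n1'.
rewrite exchange_big (eq_bigr _ (fun j _ => E j)) -mulr_sumr.
have -> : \sum_(j < m) ((m%:R - j%:R) * j%:R) = m%:R * (m%:R ^+ 2 - 1) / 6 :> R.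
  by rewrite -sum_ord_mul_rev; field.
have -> : n%:R * (n%:R - b%:R) * (n%:R + b%:R) = n%:R * b%:R ^+ 2 * (m%:R ^+ 2 - 1) :> R.
  by rewrite nE; ring.
have -> : m%:R = n%:R / b%:R :> R by rewrite nE mulrAC divff // mul1r.
by field; rewrite n0' n1' b0'.
Qed.

(** * Expectations *)

(** For nonnegative functions the integral is a supremum over the simple
    functions below the integrand, which is monotone without measurability: the
    gap of the output can be compared with its bound as it stands. *)
Lemma ge0_integral_mono (disp : measure_display) (T : measurableType disp)
    (R : realType) (mu : {measure set T -> \bar R}) (f g : T -> \bar R) :
  (forall x, (0 <= f x)%E) -> (forall x, (f x <= g x)%E) ->
  (\int[mu]_x f x <= \int[mu]_x g x)%E.
Proof.
move=> f0 fg.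
rewrite !ge0_integralTE // => [|x]; last exact: le_trans (f0 x) (fg x).
apply: ereal_sup_le => _ [h hf <-].
by exists h => // x; exact: le_trans (hf x) (fg x).
Qed.

(** A function of a random permutation is a finite combination of the indicators
    of the events that the permutation takes a given value. *)
Lemma integral_uniform_perm (R : realType) (disp : measure_display)
    (T : measurableType disp) (P : probability T R) (n : nat) (p : T -> 'S_n)
    (phi : 'S_n -> R) :
  uniform_perm P p -> (forall s, 0 <= phi s) ->
  measurable_fun setT (fun w => (phi (p w))%:E) /\
  (\int[P]_w (phi (p w))%:E = (n`!%:R^-1 * \sum_s phi s)%:E)%E.
Proof.
move=> up phi0.
have E : (fun w => (phi (p w))%:E) =
   (fun w => \sum_(s : 'S_n) (phi s * \1_(p @^-1` [set s]) w)%:E)%E.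
  apply/funext => w; rewrite sumEFin (bigD1 (p w)) //= indicE mem_set // mulr1.
  rewrite big1 ?addr0 // => s sp; rewrite indicE memNset ?mulr0 //= => pws.
  by rewrite pws eqxx in sp.
have mf s : measurable_fun setT (fun w => (phi s * \1_(p @^-1` [set s]) w)%:E).
  apply/measurable_EFinP; apply: measurable_funM => //.
  exact: measurable_indic (up s).1.
split; first by rewrite E; exact: emeasurable_sum.
rewrite E ge0_integral_sum //=; last first.
  by move=> s w _; rewrite lee_fin mulr_ge0.
rewrite mulr_sumr -sumEFin; apply: eq_bigr => s _; have [ms Ps] := up s.
rewrite (@integralZl_indic _ _ _ _ _ measurableT (fun _ => p @^-1` [set s])) //.
  rewrite integral_indic // setIT.
  apply: etrans (congr1 (fun t => (phi s)%:E * t)%E Ps) _.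
  by rewrite -EFinM mulrC.
by move=> /lt_geF; rewrite phi0.
Qed.

Lemma expectation_le_uniform_perms (R : realType) (disp : measure_display)
    (T : measurableType disp) (P : probability T R) (n : nat) (I : Type)
    (r : seq I) (p : I -> T -> 'S_n) (X : T -> R) (c : R) (phi : I -> 'S_n -> R) :
  (forall k, uniform_perm P (p k)) -> 0 <= c -> (forall k s, 0 <= phi k s) ->
  (forall w, 0 <= X w) -> (forall w, X w <= c + \sum_(k <- r) phi k (p k w)) ->
  ('E_P[X] <= (c + \sum_(k <- r) n`!%:R^-1 * \sum_s phi k s)%:E)%E.
Proof.
move=> up c0 phi0 X0 Xle; rewrite unlock.
pose g k w := (phi k (p k w))%:E.
apply: (@le_trans _ _ (\int[P]_w (c%:E + \sum_(k <- r) g k w)))%E.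
  apply: ge0_integral_mono => w; first by rewrite lee_fin.
  by rewrite /g sumEFin -EFinD lee_fin.
have mg k : measurable_fun setT (g k) by have [] := integral_uniform_perm (up k) (phi0 k).
have g0 k w : (0 <= g k w)%E by rewrite lee_fin.
rewrite ge0_integralD //; last 2 first.
- by move=> w _; apply: sume_ge0.
- exact: emeasurable_sum.
rewrite integral_cst //= probability_setT mule1 ge0_integral_sum // EFinD -sumEFin.
rewrite leeD2l // (eq_bigr _ (fun k _ => (integral_uniform_perm (up k) (phi0 k)).2)).
exact: lexx.
Qed.

(** * Convergence *)

Lemma sum_steps_gt0 (R : realType) (eta : nat -> R) (K : nat) : (1 <= K)%N ->
  (forall k, (1 <= k <= K)%N -> 0 < eta k) -> 0 < \sum_(1 <= k < K.+1) eta k.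
Proof.
move=> K1 eta0; rewrite big_ltn // ltr_wpDr ?eta0 // big_nat sumr_ge0 // => k.
by move=> /andP[k1 kK]; rewrite ltW // eta0 // ltnW.
Qed.

Section Convergence.
Variables (R : realType) (d b m : nat).
Local Notation n := (b * m)%N.
Variables (a : 'I_n -> 'cV[R]_d) (ell : 'I_n -> R -> R) (L : 'I_n -> R).
Hypothesis L_gt0 : forall i, 0 < L i.
Hypothesis ell_cvx : forall i, convex_function [set: convex_lmodType R^o] (ell i).
Hypothesis ell_smooth : forall i, L_smooth (L i) (ell i).
Hypotheses (b_gt0 : (0 < b)%N) (m_gt0 : (0 < m)%N).
Variables (x0 xs : 'cV[R]_d) (K : nat).
Hypothesis xs_min : forall x, objective a ell xs <= objective a ell x.

Local Notation f := (objective a ell).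
Local Notation sgd := (sgd_iter a ell).
Local Notation out := (sgd_output a ell).

(** Jensen's inequality, from the tangent of the objective at the average. *)
Lemma objective_jensen (r : seq nat) (w : nat -> R) (z : nat -> 'cV[R]_d) :
  (forall k, k \in r -> 0 <= w k) -> \sum_(k <- r) w k != 0 ->
  (\sum_(k <- r) w k) * f ((\sum_(k <- r) w k)^-1 *: \sum_(k <- r) w k *: z k) <=
  \sum_(k <- r) w k * f (z k).
Proof.
move=> w0; set W := \sum_(k <- r) w k => W0; set zb := W^-1 *: _.
pose g := n%:R^-1 *: \sum_i derive1 (ell i) (dot (a i) zb) *: a i.
have tangent z' : f zb + dot g (z' - zb) <= f z'.
  rewrite /objective /g dotZl dot_suml -mulrDr -big_split ler_wpM2l ?invr_ge0 //.
  apply: ler_sum => i _ /=; rewrite dotZl dotBr.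
  exact: convex_ge_tangent (ell_cvx i) (ell_smooth i) _ _.
apply: (@le_trans _ _ (\sum_(k <- r) w k * (f zb + dot g (z k - zb)))); last first.
  by rewrite big_seq [leRHS]big_seq ler_sum // => k kr; rewrite ler_wpM2l ?w0.
under eq_bigr => k _ do rewrite mulrDr.
rewrite big_split /= -mulr_suml -/W lerDl.
under eq_bigr => k _ do rewrite dotBr mulrBr -dotZr.
rewrite sumrB -mulr_suml -dot_sumr -/W -dotZr -dotBr.
by rewrite /zb scalerA divff // scale1r subrr dot0r.
Qed.

(** The part of the bound on one epoch that does not telescope. *)
Definition tail_residual (s : 'S_n) : R :=
  \sum_(j < m) dot (tail_sum a s (derivs_at a ell s xs) j)
                   (tail_sum a s (derivs_at a ell s xs) j).

Lemma tail_residual_ge0 (s : 'S_n) : 0 <= tail_residual s.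
Proof. by apply: sumr_ge0 => j _; exact: dot_ge0. Qed.

Lemma Ltilde_ge0 : 0 <= Ltilde a L.
Proof. exact: le_trans (Ltilde_perm_ge0 a L 1%g) (Ltilde_perm_le a L 1%g). Qed.

Lemma Lhat_ge0 : 0 <= Lhat a L.
Proof. exact: le_trans (Lhat_perm_ge0 a L 1%g) (Lhat_perm_le a L 1%g). Qed.

Section Path.
Variables (eta : nat -> R) (s : nat -> 'S_n).
Hypothesis eta_gt0 : forall k, (1 <= k <= K)%N -> 0 < eta k.
Hypothesis eta_le : forall k, (1 <= k <= K)%N ->
  ((eta k)%:E <= step_bound a L (s k))%E.

Lemma sum_epoch_descent (k : nat) : (k <= K)%N ->
  \sum_(1 <= i < k.+1) eta i * (f (sgd eta s x0 i) - f xs) <=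
  b%:R / (2 * n%:R) * (l2norm (x0 - xs) ^+ 2 - l2norm (sgd eta s x0 k - xs) ^+ 2)
  + \sum_(1 <= i < k.+1) eta i ^+ 3 * Ltilde a L / (b%:R * n%:R) * tail_residual (s i).
Proof.
elim: k => [|k IH] kK; first by rewrite !big_geq // subrr mulr0 addr0.
rewrite !(big_nat_recr k.+1) //=.
have kK' : (1 <= k.+1 <= K)%N by rewrite kK.
have n_gt0 : (0 < n)%N by rewrite muln_gt0 b_gt0.
have step := (step_bound_sqr a L (s k.+1) n_gt0 (eta_gt0 kK')).1 (eta_le kK').
have := epoch_descent L_gt0 ell_cvx ell_smooth b_gt0 m_gt0 (sgd eta s x0 k) xs
  (eta_gt0 kK') step.
rewrite -/(tail_residual _).
have : eta k.+1 ^+ 3 * Ltilde_perm a L (s k.+1) / (b%:R * n%:R) * tail_residual (s k.+1)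
  <= eta k.+1 ^+ 3 * Ltilde a L / (b%:R * n%:R) * tail_residual (s k.+1).
  apply: ler_wpM2r; first exact: tail_residual_ge0.
  apply: ler_wpM2r; first by rewrite invr_ge0 mulr_ge0.
  apply: ler_wpM2l; last exact: Ltilde_perm_le.
  by rewrite exprn_ge0 // ltW // eta_gt0.
move: (IH (ltnW kK)); set e := epoch _ _ _ _ _.
move: (\sum_(1 <= i < k.+1) _) (\sum_(1 <= i < k.+1) _) => S1 S2.
lra.
Qed.

Lemma sgd_output_le : (1 <= K)%N ->
  (\sum_(1 <= k < K.+1) eta k) * (f (out eta s x0 K) - f xs) <=
  b%:R / (2 * n%:R) * l2norm (x0 - xs) ^+ 2
  + \sum_(1 <= k < K.+1) eta k ^+ 3 * Ltilde a L / (b%:R * n%:R) * tail_residual (s k).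
Proof.
move=> K1.
have eta0 k : k \in index_iota 1 K.+1 -> 0 <= eta k.
  by rewrite mem_index_iota ltnS => /eta_gt0/ltW.
have H0 : \sum_(1 <= k < K.+1) eta k != 0 by rewrite gt_eqF // sum_steps_gt0.
have := objective_jensen (sgd eta s x0) eta0 H0.
have := sum_epoch_descent (leqnn K).
under eq_bigr => k _ do rewrite mulrBr.
rewrite sumrB -mulr_suml -/(out eta s x0 K) mulrBr.
have : 0 <= b%:R / (2 * n%:R) * l2norm (sgd eta s x0 K - xs) ^+ 2.
  by rewrite mulr_ge0 ?sqr_ge0 // divr_ge0 // mulr_ge0.
rewrite mulrBr; lra.
Qed.

End Path.

(** The pathwise bound is a sum of functions of single permutations, so its
    expectation is computed epoch by epoch.  The factor [r] serves both the gap
    weighted by the sum of the steps and the plain gap. *)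
Lemma sgd_expectation (disp : measure_display) (T : measurableType disp)
    (P : probability T R) (pi : nat -> T -> 'S_n) (eta : nat -> R) (r : R) :
  (1 < n)%N -> (1 <= K)%N ->
  (forall k, (1 <= k <= K)%N -> uniform_perm P (pi k)) ->
  (forall k, (1 <= k <= K)%N -> 0 < eta k) ->
  (forall k w, (1 <= k <= K)%N -> ((eta k)%:E <= step_bound a L (pi k w))%E) ->
  0 <= r ->
  ('E_P[fun w => (r * (f (out eta (pi ^~ w) x0 K) - f xs))%R] <=
   (r / (\sum_(1 <= k < K.+1) eta k) *
    (b%:R / (2 * n%:R) * l2norm (x0 - xs) ^+ 2 +
     \sum_(1 <= k < K.+1)
       eta k ^+ 3 * Ltilde a L * (n%:R - b%:R) * (n%:R + b%:R)
       / (6 * b%:R ^+ 2 * (n%:R - 1)) * sigma_sq a ell xs))%R%:E)%E.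
Proof.
move=> n1 K1 pi_unif eta_gt0 eta_le r0; set H := \sum_(1 <= k < K.+1) eta k.
have H0 : 0 < H by exact: sum_steps_gt0.
have n_gt0 : (0 < n)%N by exact: ltnW.
have rH0 : 0 <= r / H by rewrite divr_ge0 // ltW.
have kK (k : 'I_K) : (1 <= k.+1 <= K)%N by rewrite ltn_ord.
pose c := r / H * (b%:R / (2 * n%:R) * l2norm (x0 - xs) ^+ 2).
pose phi (k : 'I_K) (s : 'S_n) :=
  r / H * (eta k.+1 ^+ 3 * Ltilde a L / (b%:R * n%:R)) * tail_residual s.
have phi0 k s : 0 <= phi k s.
  apply: mulr_ge0 (tail_residual_ge0 _); apply: mulr_ge0 => //.
  apply: divr_ge0; last by rewrite mulr_ge0.
  by apply: mulr_ge0 (Ltilde_ge0); rewrite exprn_ge0 // ltW // eta_gt0.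
have c0 : 0 <= c.
  by rewrite mulr_ge0 // mulr_ge0 ?sqr_ge0 // divr_ge0 // mulr_ge0.
have := @expectation_le_uniform_perms _ _ _ P _ _ (index_enum 'I_K)
  (fun k => pi k.+1) (fun w => r * (f (out eta (pi ^~ w) x0 K) - f xs)) c phi
  (fun k => pi_unif _ (kK k)) c0 phi0.
have E : c + \sum_(k < K) n`!%:R^-1 * (\sum_s phi k s) = r / H *
    (b%:R / (2 * n%:R) * l2norm (x0 - xs) ^+ 2 +
     \sum_(1 <= k < K.+1)
       eta k ^+ 3 * Ltilde a L * (n%:R - b%:R) * (n%:R + b%:R)
       / (6 * b%:R ^+ 2 * (n%:R - 1)) * sigma_sq a ell xs).
  rewrite mulrDr; congr (_ + _); rewrite big_add1 big_mkord mulr_sumr.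
  apply: eq_bigr => k _; rewrite -mulr_sumr mulrCA.
  rewrite (mean_tail_sums n1 (gradient_at_minimizer n_gt0 ell_smooth xs_min)).
  have b0 : b%:R != 0 :> R by rewrite pnatr_eq0 -lt0n.
  have n0 : n%:R != 0 :> R by rewrite pnatr_eq0 -lt0n.
  have n1' : n%:R - 1 != 0 :> R by rewrite subr_eq0 -[1]/(1%:R) eqr_nat gtn_eqF.
  move: (n%:R) (b%:R) n0 n1' b0 => N B n0 n1' b0.
  by field; rewrite n0 n1' b0 gt_eqF.
rewrite E; apply => w.
  by rewrite mulr_ge0 // subr_ge0.
have := sgd_output_le eta_gt0 (fun k => @eta_le k w) K1.
rewrite -/H => /(ler_wpM2l rH0); rewrite [r / H * (H * _)]mulrA divfK ?gt_eqF //.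
rewrite [r / H * (_ + _)]mulrDr -/c.
move=> /le_trans; apply; rewrite lerD2l mulr_sumr big_add1 big_mkord.
by apply: ler_sum => k _; rewrite /phi mulrA.
Qed.

End Convergence.

Lemma uniform_of_shuffling (R : realType) (disp : measure_display)
    (T : measurableType disp) (P : probability T R) (n K : nat)
    (pi : nat -> T -> 'S_n) :
  shuffle_once P K pi \/ random_reshuffling P K pi ->
  forall k, (1 <= k <= K)%N -> uniform_perm P (pi k).
Proof.
case=> [[p up pip] k kK|[up _] k /up //].
by have -> : pi k = p by apply/funext => w; exact: pip.
Qed.

Lemma small_step (R : realType) (A B q1 q2 : R) :
  0 <= A -> 0 <= B -> 0 < q1 -> 0 < q2 ->
  exists2 eta, 0 < eta & eta ^+ 2 * A <= q1 /\ eta ^+ 2 * B <= q2.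
Proof.
move=> A0 B0 q10 q20; pose D := 1 + A / q1 + B / q2.
have A0' : 0 <= A / q1 by rewrite divr_ge0 // ltW.
have B0' : 0 <= B / q2 by rewrite divr_ge0 // ltW.
have D1 : 1 <= D by rewrite /D; lra.
have D0 : 0 < D by lra.
have e1 : D^-1 ^+ 2 <= D^-1.
  by rewrite expr2 ler_piMl ?invf_le1 // invr_ge0 ltW.
exists D^-1; first by rewrite invr_gt0.
split; [apply: le_trans (ler_wpM2r A0 e1) _|apply: le_trans (ler_wpM2r B0 e1) _];
  rewrite mulrC ler_pdivrMr // mulrC -ler_pdivrMr // /D; lra.
Qed.

(** With target accuracy [eps], the step that makes the distance term equal to
    [eps / 2] meets the step-size restriction when the first term of the
    complexity bound is at most half the number of queries, and makes the
    variance term at most [eps / 24] when the second one is. *)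
Lemma complexity_step (R : realType) (N B K D Lh Lt sig eps : R) :
  1 < N -> 0 < B -> B <= N -> 0 < K -> 0 <= D -> 0 <= Lh -> 0 <= Lt -> 0 <= sig ->
  0 < eps ->
  2 * (N * Num.sqrt (Lh * Lt) * D / eps
       + Num.sqrt ((N - B) * (N + B) / (N * (N - 1)))
         * (Num.sqrt (N * Lt) * Num.sqrt sig * D / (eps `^ (3 / 2)))) <= N * K ->
  exists2 eta : R, 0 < eta &
    eta ^+ 2 * N ^+ 2 * (2 * Lh * Lt) <= B ^+ 2 /\
    B / (2 * N) * D / (K * eta)
      + eta ^+ 2 * (Lt * (N - B) * (N + B) / (6 * B ^+ 2 * (N - 1)) * sig) <= eps.
Proof.
move=> N1 B0 BN K0 D0 Lh0 Lt0 sig0 eps0 HK.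
have N0 : 0 < N by apply: lt_trans N1.
have N10 : 0 < N - 1 by rewrite subr_gt0.
have NB0 : 0 <= (N - B) * (N + B) by rewrite mulr_ge0 ?subr_ge0 // addr_ge0 // ltW.
have NK0 : 0 < N * K by rewrite mulr_gt0.
set M := _ / (6 * _ * _) * sig.
have M0 : 0 <= M.
  rewrite /M mulr_ge0 // divr_ge0 //; first by rewrite -mulrA mulr_ge0.
  by rewrite mulr_ge0 ?mulr_ge0 ?sqr_ge0 // ltW.
have Q0 : 0 <= N ^+ 2 * (2 * Lh * Lt) by rewrite mulr_ge0 ?sqr_ge0 // !mulr_ge0.
(* For [D = 0] the step [B * D / (N * K * eps)] vanishes; any small step does. *)
have [Dz|Dn] := eqVneq D 0.
  have [eta eta0 [e1 e2]] := small_step Q0 M0 (exprn_gt0 2 B0) eps0.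
  by exists eta => //; rewrite Dz mulr0 mul0r add0r -mulrA.
have Dp : 0 < D by rewrite lt_neqAle eq_sym Dn.
set T1 := N * _ * D / eps in HK; set T2 := _ * (_ * _ * _ / _) in HK.
have p0 : 0 < eps `^ (3 / 2) by exact: powR_gt0.
have T10 : 0 <= T1 by rewrite divr_ge0 ?mulr_ge0 ?sqrtr_ge0 // ltW.
have T20 : 0 <= T2.
  by rewrite mulr_ge0 ?sqrtr_ge0 // divr_ge0 ?mulr_ge0 ?sqrtr_ge0 // ltW.
have T1sq : T1 ^+ 2 = N ^+ 2 * (Lh * Lt) * D ^+ 2 / eps ^+ 2.
  by rewrite expr_div_n !exprMn sqr_sqrtr // mulr_ge0.
have T2sq : T2 ^+ 2 = (N - B) * (N + B) / (N * (N - 1))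
     * (N * Lt * sig * D ^+ 2 / eps ^+ 3).
  have NLt0 : 0 <= N * Lt by rewrite mulr_ge0 // ltW.
  have frac0 : 0 <= (N - B) * (N + B) / (N * (N - 1)).
    by rewrite divr_ge0 // mulr_ge0 // ltW.
  rewrite exprMn expr_div_n !exprMn (sqr_sqrtr frac0) (sqr_sqrtr NLt0) (sqr_sqrtr sig0).
  have -> : (eps `^ (3 / 2)) ^+ 2 = eps ^+ 3; last by [].
  rewrite -(powR_mulrn _ (powR_ge0 _ _)) -powRrM divfK ?pnatr_eq0 //.
  exact: powR_mulrn (ltW eps0).
have le_half (t : R) : 0 <= t -> 2 * t <= N * K -> 4 * t ^+ 2 <= (N * K) ^+ 2.
  move=> t0 tNK; have -> : 4 * t ^+ 2 = (2 * t) ^+ 2 by ring.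
  by rewrite ler_sqr ?nnegrE ?(ltW NK0) // mulr_ge0.
have h1 := le_half _ T10 ltac:(lra).
have h2 := le_half _ T20 ltac:(lra).
exists (B * D / (N * K * eps)); first by rewrite divr_gt0 ?mulr_gt0.
have NKsq : 0 < (N * K) ^+ 2 by rewrite exprn_gt0.
split.
  have -> : (B * D / (N * K * eps)) ^+ 2 * N ^+ 2 * (2 * Lh * Lt)
     = B ^+ 2 * (2 * T1 ^+ 2 / (N * K) ^+ 2).
    by rewrite T1sq; field; rewrite !gt_eqF.
  rewrite -[leRHS]mulr1 ler_wpM2l ?sqr_ge0 // ler_pdivrMr // mul1r.
  by have := sqr_ge0 T1; lra.
have -> : B / (2 * N) * D / (K * (B * D / (N * K * eps))) = eps / 2.
  by field; rewrite !gt_eqF.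
have -> : (B * D / (N * K * eps)) ^+ 2 * M = eps / 6 * (T2 ^+ 2 / (N * K) ^+ 2).
  by rewrite /M T2sq; field; rewrite !gt_eqF.
have : T2 ^+ 2 / (N * K) ^+ 2 <= 1.
  by rewrite ler_pdivrMr // mul1r; have := sqr_ge0 T2; lra.
have e6 : 0 <= eps / 6 by lra.
by move=> /(ler_wpM2l e6); lra.
Qed.

Theorem theorem1 (R : realType) :
  exists C : R, 0 < C /\
  forall (d b m : nat), let n := (b * m)%N in
  (1 <= d)%N -> (1 <= b)%N -> (1 <= m)%N -> (2 <= n)%N ->
  forall (a : 'I_n -> 'cV[R]_d) (ell : 'I_n -> R -> R) (L : 'I_n -> R),
  (forall i, 0 < L i) ->
  (forall i, convex_function [set: convex_lmodType R^o] (ell i)) ->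
  (forall i, L_smooth (L i) (ell i)) ->
  let f := objective a ell in
  forall xstar : 'cV[R]_d, (forall x, f xstar <= f x) ->
  let sigma2 := sigma_sq a ell xstar in
  forall (x0 : 'cV[R]_d) (K : nat), (1 <= K)%N ->
  forall (disp : measure_display) (T : measurableType disp)
    (P : probability T R) (pi : nat -> T -> 'S_n),
  shuffle_once P K pi \/ random_reshuffling P K pi ->
  (forall eta : nat -> R,
    (forall k, (1 <= k <= K)%N -> 0 < eta k) ->
    (forall k w, (1 <= k <= K)%N -> ((eta k)%:E <= step_bound a L (pi k w))%E) ->
    let H := \sum_(1 <= k < K.+1) eta k in
    ('E_P[fun w => (H * (f (sgd_output a ell eta (pi ^~ w) x0 K) - f xstar))%R] <=
     (b%:R / (2 * n%:R) * l2norm (x0 - xstar) ^+ 2 +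
      \sum_(1 <= k < K.+1)
        eta k ^+ 3 * Ltilde a L * (n%:R - b%:R) * (n%:R + b%:R)
        / (6 * b%:R ^+ 2 * (n%:R - 1)) * sigma2)%R%:E)%E) /\
  (forall eps : R, 0 < eps ->
    C * (n%:R * Num.sqrt (Lhat a L * Ltilde a L) * l2norm (x0 - xstar) ^+ 2 / eps
         + Num.sqrt ((n%:R - b%:R) * (n%:R + b%:R) / (n%:R * (n%:R - 1)))
           * (Num.sqrt (n%:R * Ltilde a L) * Num.sqrt sigma2
              * l2norm (x0 - xstar) ^+ 2 / (eps `^ (3 / 2))))
      <= (n * K)%:R ->
    exists eta : R, 0 < eta /\
      ('E_P[fun w => (f (sgd_output a ell (fun=> eta) (pi ^~ w) x0 K)
                      - f xstar)%R] <= eps%:E)%E).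
Proof.
exists 2; split; first by [].
move=> d b m n d1 b1 m1 n2 a ell L L0 cvx smooth f xstar xmin sigma2 x0 K K1.
move=> disp T P pi shuffling.
have unif := uniform_of_shuffling shuffling.
have expect := sgd_expectation L0 cvx smooth b1 m1 x0 xmin n2 K1 unif.
split=> [eta eta0 eta_le|eps eps0 HK].
  pose H := \sum_(1 <= k < K.+1) eta k.
  have H0 : 0 < H by exact: sum_steps_gt0.
  have := expect eta H eta0 eta_le (ltW H0).
  by rewrite -/H divff ?gt_eqF // mul1r.
have N1 : 1 < n%:R :> R by rewrite ltr1n.
have B0 : 0 < b%:R :> R by rewrite ltr0n.
have BN : b%:R <= n%:R :> R by rewrite ler_nat leq_pmulr.
have Kp : 0 < K%:R :> R by rewrite ltr0n.
have sig0 : 0 <= sigma2.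
  rewrite /sigma2 /sigma_sq mulr_ge0 ?invr_ge0 // sumr_ge0 // => i _.
  by rewrite mulr_ge0 ?sqr_ge0.
rewrite natrM in HK.
have [eta eta0 [step bound]] := complexity_step N1 B0 BN Kp
  (sqr_ge0 (l2norm (x0 - xstar))) (Lhat_ge0 a L) (Ltilde_ge0 a L) sig0 eps0 HK.
exists eta; split=> //.
have eta_le k w : (1 <= k <= K)%N -> (eta%:E <= step_bound a L (pi k w))%E.
  move=> _; apply: (step_bound_sqr a L (pi k w) (ltnW n2) eta0).2.
  apply: le_trans step; apply: ler_wpM2l; first by rewrite mulr_ge0 ?sqr_ge0.
  apply: ler_pM; rewrite ?Ltilde_perm_ge0 ?Ltilde_perm_le //.
    by rewrite mulr_ge0 ?Lhat_perm_ge0.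
  by rewrite ler_wpM2l ?Lhat_perm_le.
have := expect (fun=> eta) 1 (fun _ _ => eta0) eta_le ler01.
under eq_fun do rewrite mul1r.
move=> /le_trans; apply; rewrite lee_fin; apply: le_trans bound.
have const_sum (c : R) : \sum_(1 <= k < K.+1) c = K%:R * c.
  by rewrite sumr_const_nat subSS subn0 mulr_natl.
rewrite !const_sum -/n -/sigma2.
rewrite le_eqVlt; apply/orP; left; apply/eqP.
have N0 : n%:R - 1 != 0 :> R by rewrite gt_eqF // subr_gt0.
have N0' : n%:R != 0 :> R by rewrite gt_eqF // (lt_trans ltr01).
move: (n%:R) (b%:R) (K%:R) N0 N0' B0 Kp => N B k N0 N0' B0 Kp.
by field; rewrite N0 N0' !gt_eqF.
Qed.
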